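(* Let $\nu > 0$, let $\rho$ be a random variable with values in $(-1, 1)$, and let $C$ be the correlation mixture of bivariate $t$-copulas with degrees-of-freedom parameter $\nu$ and random correlation parameter $\rho$. Let $\lambda(u) = u^{-1} \, C(u, u)$ for $0 < u \le 1$ and let $\lambda = \lim_{u \downarrow 0} \lambda(u) = \operatorname{E}[\lambda_{\nu, \rho}]$, the expectation being with respect to $\rho$. Then \[ \lambda(u) = \lambda + \gamma \, u^{2/\nu} + o(u^{2/\nu}), \qquad u \downarrow 0, \] where $\gamma$ is the positive constant, depending on $\nu$ and the distribution of $\rho$, given by \[ \gamma = \bigl( a_\nu \, \operatorname{E}[Z_+^\nu] \bigr)^{-2/\nu} \, b_\nu \, (\nu + 1) \, \operatorname{E}[\lambda_{\nu, \rho} - \lambda_{\nu+2, \rho}]. \]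
   Context: Correlation mixture of bivariate $t$-copulas: let $Z_1, Z_2, S, \rho$ be independent random variables, where $Z_1, Z_2$ are standard normal, $S > 0$ is such that $\nu S^2$ has a chi-square distribution with $\nu$ degrees of freedom, and $\rho$ takes values in $(-1,1)$. Put $X = S^{-1} Z_1$ and $Y = S^{-1} \bigl( \rho Z_1 + \sqrt{1 - \rho^2} \, Z_2 \bigr)$. Then $C$ is the (unconditional) copula of $(X, Y)$. For $\nu > 0$ and a number $r \in (-1, 1)$, \[ \lambda_{\nu, r} = 2 \, t_{\nu+1} \bigl( - \sqrt{\nu+1} \, \sqrt{1-r} / \sqrt{1+r} \bigr), \] where $t_\mu$ denotes the cumulative distribution function of the (univariate) $t$-distribution with $\mu > 0$ degrees of freedom; $\lambda_{\nu, r}$ is the coefficient of tail dependence of the $t$-copula with $\nu$ degrees of freedom and non-random correlation $r$. The constants in $\gamma$ are \[ a_\nu = \frac{(\nu/2)^{\nu/2}}{\Gamma(\nu/2+1)}, \qquad b_\nu = \frac{(\nu/2)^2}{\nu/2+1}, \qquad \operatorname{E}[Z_+^\nu] = \frac{1}{\sqrt{2\pi}} \int_0^\infty z^\nu e^{-z^2/2} \, dz = \frac{2^{\nu/2-1}}{\sqrt{\pi}} \, \Gamma \bigl( (\nu+1)/2 \bigr), \] where $Z$ is a standard normal random variable and $x_+ = \max(x, 0)$. *)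

(* Defs.v *)
From HB Require Import structures.
From mathcomp Require Import all_boot all_order all_algebra.
From mathcomp Require Import all_classical all_reals all_analysis.

Set Implicit Arguments.
Unset Strict Implicit.
Unset Printing Implicit Defensive.

Import Order.TTheory GRing.Theory Num.Theory.
Import numFieldNormedType.Exports.

Local Open Scope classical_set_scope.
Local Open Scope ring_scope.

(* Euler's Gamma function; the integral converges for 0 < x, the only
   arguments at which it is used. *)
Definition Gamma {R : realType} (x : R) : R :=
  \int[lebesgue_measure]_(t in `]0, +oo[) (t `^ (x - 1) * expR (- t)).

Definition chi_square_pdf {R : realType} (nu x : R) : R :=
  if 0 < x then
    x `^ (nu / 2 - 1) * expR (- (x / 2)) / (2 `^ (nu / 2) * Gamma (nu / 2))
  else 0.

Definition chi_square_prob {R : realType} (nu : R) : set R -> \bar R :=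
  fun A => (\int[lebesgue_measure]_(x in A) (chi_square_pdf nu x)%:E)%E.

Definition student_pdf {R : realType} (mu x : R) : R :=
  Gamma ((mu + 1) / 2) / (Num.sqrt (mu * pi) * Gamma (mu / 2))
    * (1 + x ^+ 2 / mu) `^ (- ((mu + 1) / 2)).

Definition student_cdf {R : realType} (mu x : R) : R :=
  \int[lebesgue_measure]_(y in `]-oo, x]) student_pdf mu y.

(* The law of X is the set function mu. X is a bare function so that
   transforms of random variables can be used directly; distributions are
   compared on measurable sets only. *)
Definition has_law {d} {T : measurableType d} {R : realType}
    (P : probability T R) (X : T -> R) (mu : set R -> \bar R) : Prop :=
  forall A : set R, measurable A -> P (X @^-1` A) = mu A.

Definition mutually_independent {d} {T : measurableType d} {R : realType}
    (P : probability T R) (n : nat) (X : 'I_n -> {RV P >-> R}) : Prop :=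
  forall (J : {set 'I_n}) (B : 'I_n -> set R),
    (forall i, measurable (B i)) ->
    P (\bigcap_(i in [set i | i \in J]) (X i @^-1` B i)) =
    (\big[*%E/1%E]_(i in J) P (X i @^-1` B i)).

(* Only the values of C on the unit square are constrained. *)
Definition is_copula {R : realType} (C : R -> R -> R) : Prop :=
  [/\ forall u, 0 <= u <= 1 -> C u 0 = 0 /\ C 0 u = 0,
      forall u, 0 <= u <= 1 -> C u 1 = u /\ C 1 u = u
    & forall u1 u2 v1 v2, 0 <= u1 -> u1 <= u2 -> u2 <= 1 ->
        0 <= v1 -> v1 <= v2 -> v2 <= 1 ->
        0 <= C u2 v2 - C u2 v1 - C u1 v2 + C u1 v1].

(* Sklar's identity; it determines C on the unit square when the marginal
   distribution functions are continuous. *)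
Definition copula_of {d} {T : measurableType d} {R : realType}
    (P : probability T R) (X Y : {RV P >-> R}) (C : R -> R -> R) : Prop :=
  is_copula C /\
  forall x y : R,
    P ((X @^-1` `]-oo, x]) `&` (Y @^-1` `]-oo, y])) =
    (C (fine (cdf X x)) (fine (cdf Y y)))%:E.

(* lambda_{nu,r}: the coefficient of tail dependence of the t-copula. *)
Definition tail_coef {R : realType} (nu r : R) : R :=
  2 * student_cdf (nu + 1)
        (- (Num.sqrt (nu + 1) * Num.sqrt (1 - r) / Num.sqrt (1 + r))).

Definition a_const {R : realType} (nu : R) : R :=
  (nu / 2) `^ (nu / 2) / Gamma (nu / 2 + 1).

Definition b_const {R : realType} (nu : R) : R :=
  (nu / 2) ^+ 2 / (nu / 2 + 1).

(* E[Z_+^nu] for a standard normal Z. *)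
Definition normal_pos_moment {R : realType} (nu : R) : R :=
  fine ('E_(normal_prob 0 1)[(fun z : R => (Num.max z 0) `^ nu)%R])%E.

Definition gamma_const {d} {T : measurableType d} {R : realType}
    (P : probability T R) (nu : R) (rho : {RV P >-> R}) : R :=
  (a_const nu * normal_pos_moment nu) `^ (- (2 / nu))
    * b_const nu * (nu + 1)
    * fine ('E_P[(fun w => tail_coef nu (rho w) - tail_coef (nu + 2) (rho w))%R])%E.

(* Main.v *)
Require Import Defs.
From HB Require Import structures.
From mathcomp Require Import all_boot all_order all_algebra.
From mathcomp Require Import all_classical all_reals all_analysis.
From mathcomp Require Import measurable_realfun measurable_fun_approximation simple_functions ring lra.

Set Implicit Arguments.
Unset Strict Implicit.
Unset Printing Implicit Defensive.

Import Order.TTheory GRing.Theory Num.Theory.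
Import numFieldNormedType.Exports.

Local Open Scope classical_set_scope.
Local Open Scope ring_scope.


(** For h > 0 the events X <= -1/h and Y <= -1/h are S <= h U and S <= h V, where U = -Z1 and V =
    -(rho Z1 + sqrt (1 - rho^2) Z2); both hold exactly when S <= h min(U, V). Thus the two margins
    and the joint distribution function at -1/h are all of the form P(S <= h W) with W independent
    of S. Near 0 the distribution function of S is a s^nu (1 - b s^2 + O(s^4)), where a =
    [a_const nu] and b = [b_const nu] ([chi_square_cdf_expansion]). Averaging over W gives a h^nu
    (E[W_+^nu] - b h^2 E[W_+^(nu+2)] + O(h^4)) ([scale_mixture_expansion]).

    The moments are explicit. Let m_p = E[Z_+^p] for a standard normal Z. Given rho, U and V are
    standard normal with correlation rho, so E[U_+^p] = E[V_+^p] = m_p, while E[min(U, V)_+^p] = m_p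
    E[lambda_{p,rho}] ([normal_min_moment]): by exchangeability this moment is twice its part on U
    <= V, and passing to the ratio of two independent normal variables turns that part into a tail
    of the t-distribution with p + 1 degrees of freedom. Since m_{nu+2} = (nu + 1) m_nu, putting A =
    a m_nu, beta = b (nu + 1) and l1 = E[lambda_{nu+2,rho}] makes both margins at -1/h equal to A
    h^nu (1 - beta h^2 + O(h^4)) and the joint value equal to A h^nu (lambda - beta l1 h^2 +
    O(h^4)).

    Now put u = A h^nu (1 - beta h^2). A copula is Lipschitz ([copula_lipschitz]), so the margins
    may be replaced by u inside C. Division by u gives lambda + beta (lambda - l1) h^2 + O(h^4), and
    h^2 = (u/A)^(2/nu) (1 + O(h^2)); this is the expansion, even with remainder O(u^(4/nu))
    ([copula_diag_expansion]). Positivity of gamma is the strict inequality lambda_{p+2,r} <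
    lambda_{p,r} ([tail_coef_lt]), an instance of Chebyshev's association inequality. *)

(** * Densities, affine substitution and independence *)

Section measure_theory.
Local Open Scope ereal_scope.
Import HBNNSimple.

(** Monotone convergence along the simple approximations [h n] of [f] reduces both sides to
    indicators, where the claim is the hypothesis on [m]. It is used to write normal expectations as
    Lebesgue integrals. *)
Lemma ge0_integral_density d (T : measurableType d) (R : realType)
    (m mu : {measure set T -> \bar R}) (g : T -> R) (f : T -> \bar R) :
  measurable_fun setT g -> (forall x, (0 <= g x)%R) ->
  (forall A, measurable A -> m A = \int[mu]_(x in A) (g x)%:E) ->
  measurable_fun setT f -> (forall x, 0 <= f x) ->
  \int[m]_x f x = \int[mu]_x (f x * (g x)%:E).
Proof.
move=> mg g0 mE mf f0.
have mEg : measurable_fun setT (EFin \o g) by apply/measurable_EFinP.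
pose h := nnsfun_approx measurableT mf.
have hf x : (EFin \o h n) x @[n --> \oo] --> f x by exact: cvg_nnsfun_approx.
have h_nd x : {homo (fun n => (h n x)%:E) : a b / (a <= b)%N >-> a <= b}.
  by move=> a b ab; rewrite lee_fin; exact/lefP/nd_nnsfun_approx.
have -> : \int[m]_x f x = lim (\int[m]_x (EFin \o h n) x @[n --> \oo]).
  under eq_integral => x _ do rewrite -(cvg_lim _ (hf x))//.
  apply: monotone_convergence => //.
  - by move=> n; apply/measurable_EFinP.
  - by move=> n x _ /=; rewrite lee_fin.
  - by move=> x _; exact: h_nd.
have -> : \int[mu]_x (f x * (g x)%:E) =
    lim (\int[mu]_x ((EFin \o h n) x * (g x)%:E) @[n --> \oo]).
  have fg x : f x * (g x)%:E = lim (((EFin \o h n) x * (g x)%:E) @[n --> \oo]).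
    by apply/esym/cvg_lim => //; apply: cvgeZr.
  under eq_integral => x _ do rewrite fg.
  apply: monotone_convergence => //.
  - by move=> n; apply/emeasurable_funM => //; exact/measurable_EFinP.
  - by move=> n x _ /=; rewrite mule_ge0 ?lee_fin.
  - by move=> x _ a b ab /=; rewrite lee_wpmul2r ?lee_fin//; exact: (h_nd x).
suff suf n : \int[mu]_x ((EFin \o h n) x * (g x)%:E) = \int[m]_x (EFin \o h n) x.
  by apply/esym; congr (lim (_ @ \oo)); exact/funext.
have indich r : measurable_fun setT (fun x => (r * \1_(h n @^-1` [set r]) x)%:E).
  by apply/measurable_EFinP; exact: measurable_funM.
transitivity (\int[m]_x
   (\sum_(y \in range (h n)) (y * \1_(h n @^-1` [set y]) x)%:E)); last first.
  by apply: eq_integral => t tE; rewrite /= fimfunE -fsumEFin.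
rewrite ge0_integral_fsum//; last by move=> r y Ey; rewrite EFinM; exact: nnfun_muleindic_ge0.
transitivity (\int[mu]_x (\sum_(y \in range (h n))
    (y * \1_(h n @^-1` [set y]) x)%:E * (g x)%:E)).
  apply: eq_integral => x _; rewrite -ge0_mule_fsuml; last first.
    by move=> y; rewrite EFinM; exact: nnfun_muleindic_ge0.
  by rewrite fsumEFin//= -(fimfunE (h n) x).
rewrite (@ge0_integral_fsum _ _ _ _ _ measurableT _
    (fun y x => (y * \1_(h n @^-1` [set y]) x)%:E * (g x)%:E))//; last 2 first.
  - by move=> y; apply: emeasurable_funM.
  - by move=> r y Ey; rewrite mule_ge0 ?lee_fin// -lee_fin EFinM nnfun_muleindic_ge0.
apply: eq_fsbigr => r rhn.
under [RHS]eq_integral do rewrite EFinM.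
rewrite integralZl_indic_nnsfun => //.
under eq_integral do rewrite EFinM -muleA.
rewrite ge0_integralZl//.
- under eq_integral do rewrite muleC.
  rewrite (eq_integral ((EFin \o g) \_ (h n @^-1` [set r]))); last first.
    by move=> x xE; rewrite epatch_indic.
  by rewrite -integral_mkcond -mE// integral_indic// setIT.
- by apply: emeasurable_funM => //; exact/measurable_EFinP.
- by move=> t Et; rewrite mule_ge0 ?lee_fin.
- by move: rhn; rewrite inE => -[t _ <-]; rewrite lee_fin.
Qed.

(** Provides the pushforward as an opaque measure, known only through its values. *)
Lemma pushforward_measure_exists d d' (T : measurableType d)
    (T' : measurableType d') (R : realType) (mu : {measure set T -> \bar R})
    (f : T -> T') : measurable_fun setT f ->
  exists m : {measure set T' -> \bar R}, forall A, m A = mu (f @^-1` A).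
Proof.
move=> mf.
by unshelve eexists (pushforward mu f : {measure set T' -> \bar R}).
Qed.

(** The pushforward of Lebesgue measure under x |-> k x + b, multiplied by k, gives every interval
    ]x, y] its length, hence is Lebesgue measure. *)
Lemma ge0_integral_affine (R : realType) (k b : R) (f : R -> \bar R) :
  (0 < k)%R -> measurable_fun setT f -> (forall x, 0 <= f x) ->
  \int[lebesgue_measure]_x f (k * x + b)%R =
  (k^-1)%:E * \int[lebesgue_measure]_x f x.
Proof.
move=> k0 mf f0.
have k0' := ltW k0.
pose phi (x : measurableTypeR R) : measurableTypeR R := (k * x + b)%R.
have mphi : measurable_fun setT phi.
  by apply: measurable_funD => //; apply: measurable_funM.
have [pm pmE] := pushforward_measure_exists lebesgue_measure mphi.
have {}pmE A : pm A = @lebesgue_measure R (phi @^-1` A) := pmE A.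
pose m := mscale (NngNum k0') pm.
have mE A : measurable A -> lebesgue_measure A = m A.
  move=> mA; apply: lebesgue_measure_unique => // _ [[x y]] _ <- /=.
  rewrite /m /mscale /= pmE.
  have -> : phi @^-1` `]x, y] = `]((x - b) / k)%R, ((y - b) / k)%R]%classic.
    apply/seteqP; split => t /=; rewrite !in_itv /= /phi.
      by move=> /andP[xt ty]; rewrite ltr_pdivrMr// ler_pdivlMr//
        mulrC ltrBlDr lerBrDr xt.
    by rewrite ltr_pdivrMr// ler_pdivlMr// mulrC ltrBlDr lerBrDr.
  rewrite !lebesgue_measure_itv /= !lte_fin ltr_pM2r ?invr_gt0//.
  rewrite ltrD2r; case: ifPn => _; last by rewrite mule0.
  by rewrite -EFinD -EFinM; congr EFin; field; rewrite gt_eqF.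
transitivity (\int[pm]_x f x).
  transitivity (\int[pushforward lebesgue_measure phi]_x f x).
    by rewrite ge0_integral_pushforward.
  by apply: eq_measure_integral => A _ _; rewrite [RHS]pmE.
rewrite [in RHS](eq_measure_integral m); last by move=> A mA _; exact: mE.
rewrite /m ge0_integral_mscale//= muleA -EFinM mulVf ?mul1e//.
by rewrite gt_eqF.
Qed.

Lemma ge0_integral_opp (R : realType) (f : R -> \bar R) :
  measurable_fun setT f -> (forall x, 0 <= f x) ->
  \int[lebesgue_measure]_x f (- x)%R = \int[lebesgue_measure]_x f x.
Proof.
move=> mf f0.
transitivity (\int[pushforward lebesgue_measure
    (-%R : measurableTypeR R -> measurableTypeR R)]_x f x).
  by rewrite ge0_integral_pushforward.
by apply: eq_measure_integral => A mA _; exact: lebesgue_measureN.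
Qed.

(** The law of (U, V) restricted to [E], divided by P E, agrees with the product law on rectangles,
    so it is the product law. The event [E] carries along the variables that are independent of the
    pair. *)
Lemma independent_pair d d1 d2 (T : measurableType d) (T1 : measurableType d1)
    (T2 : measurableType d2) (R : realType) (P : probability T R)
    (U : {RV P >-> T1}) (V : {RV P >-> T2}) (E : set T) :
  measurable E ->
  (forall A B, measurable A -> measurable B ->
    P (U @^-1` A `&` V @^-1` B `&` E) = P (U @^-1` A) * P (V @^-1` B) * P E) ->
  forall D : set (T1 * T2), measurable D ->
  P ((fun w => (U w, V w)) @^-1` D `&` E) =
  (distribution P U \x distribution P V) D * P E.
Proof.
move=> mE ind D mD.
have mUV : measurable_fun setT (fun w => (U w, V w)).
  exact: measurable_fun_pair.
have mUVD : measurable ((fun w => (U w, V w)) @^-1` D).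
  by rewrite -[X in measurable X]setTI; exact: mUV.
have [PE0|PE0] := eqVneq (P E) 0.
  rewrite PE0 mule0; apply/eqP; rewrite eq_le measure_ge0 andbT -PE0.
  by apply: le_measure; rewrite ?inE//; exact: measurableI.
have PEfin : P E \is a fin_num by exact: fin_num_measure.
have PEgt : (0 < fine (P E))%R.
  by rewrite fine_gt0// lt0e PE0 measure_ge0 ltey_eq PEfin.
have PEV : (0 <= (fine (P E))^-1)%R by rewrite invr_ge0 ltW.
have [pm pmE] := pushforward_measure_exists (mrestr P mE) mUV.
have {}pmE A : pm A = P ((fun w => (U w, V w)) @^-1` A `&` E) := pmE A.
pose m := mscale (NngNum PEV) pm.
have -> : (distribution P U \x distribution P V) D = m D.
  apply: product_measure_unique => //= A B mA mB.
  rewrite /m /mscale /= pmE.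
  rewrite [X in _ * X](_ : _ = P (U @^-1` A) * P (V @^-1` B) * P E); last exact: ind.
  rewrite -[P E]fineK// muleCA -EFinM mulVf ?mule1// gt_eqF//.
rewrite /m /mscale /= pmE -[X in _ * X]fineK//.
by rewrite muleAC -EFinM mulVf ?mul1e// gt_eqF.
Qed.

(** Conditioning on [U]: the joint law is a product, and Tonelli integrates [V] out first. *)
Lemma independent_integral d d1 d2 (T : measurableType d)
    (T1 : measurableType d1) (T2 : measurableType d2) (R : realType)
    (P : probability T R) (U : {RV P >-> T1}) (V : {RV P >-> T2})
    (f : T1 * T2 -> \bar R) :
  (forall A B, measurable A -> measurable B ->
    P (U @^-1` A `&` V @^-1` B) = P (U @^-1` A) * P (V @^-1` B)) ->
  measurable_fun setT f -> (forall x, 0 <= f x) ->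
  \int[P]_w f (U w, V w) = \int[P]_w \int[distribution P V]_v f (U w, v).
Proof.
move=> ind mf f0.
have mUV : measurable_fun setT (fun w => (U w, V w)).
  exact: measurable_fun_pair.
transitivity (\int[pushforward P (fun w => (U w, V w))]_x f x).
  by rewrite ge0_integral_pushforward.
transitivity (\int[distribution P U \x distribution P V]_x f x).
  apply: eq_measure_integral => /= D mD _.
  have := @independent_pair _ _ _ _ _ _ _ P U V setT measurableT.
  rewrite probability_setT => /(_ _ D mD); rewrite setIT mule1; apply.
  by move=> A B mA mB; rewrite setIT mule1 ind.
rewrite fubini_tonelli1// ge0_integral_distribution//.
- exact: measurable_fun_fubini_tonelli_F.
- by move=> x; exact: integral_ge0.
Qed.

End measure_theory.

(** * Power integrals and Euler's Gamma function *)

Section gamma.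
Context {R : realType}.
Implicit Types (p q c u : R).
Local Notation mu := (@lebesgue_measure R).

Lemma integral_if d (T : measurableType d) (m : {measure set T -> \bar R})
    (P : pred T) (f : T -> \bar R) :
  (\int[m]_(x in [set x | P x]) f x = \int[m]_x (if P x then f x else 0))%E.
Proof.
rewrite integral_mkcond; apply: eq_integral => x _; rewrite patchE.
by case: ifPn; rewrite (inE, notin_setE)/= => Px; [rewrite Px|rewrite (negbTE (introN idP Px))].
Qed.

Lemma ge0_integralZl_fin d (T : measurableType d) (m : {measure set T -> \bar R})
    (D : set T) (k : R) (f : T -> R) :
  measurable D -> measurable_fun setT f -> (forall x, 0 <= f x) -> 0 <= k ->
  (\int[m]_(x in D) (k * f x)%:E = k%:E * \int[m]_(x in D) (f x)%:E)%E.
Proof.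
move=> mD mf f0 k0; under eq_integral do rewrite EFinM.
rewrite ge0_integralZl// ?lee_fin//.
- by apply/measurable_EFinP; exact: measurable_funTS.
- by move=> x _; rewrite lee_fin.
Qed.

Lemma integral_itv0y (f : R -> \bar R) :
  (\int[mu]_(x in `]0%R, +oo[) f x = \int[mu]_x (if (0 < x)%R then f x else 0))%E.
Proof.
rewrite (integral_if mu (fun x => x \in `]0, +oo[)).
by apply: eq_integral => x _; rewrite in_itv/= andbT.
Qed.

(** For p < 0 the integrand is singular at 0, so the fundamental theorem of calculus is applied on
    [[a n, u]] and the intervals are exhausted monotonically. *)
Lemma integral_powR p u : -1 < p -> 0 <= u ->
  (\int[mu]_(z in `]0%R, u]) (z `^ p)%:E = (u `^ (p + 1) / (p + 1))%:E)%E.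
Proof.
move=> p1; have p10 : 0 < p + 1 by rewrite -ltrBlDr sub0r.
rewrite le_eqVlt => /predU1P[<-|u0].
  rewrite set_itv_ge ?bnd_simp ?ltxx// integral_set0.
  by rewrite powR0 ?gt_eqF// mul0r.
(* The denominator starts at 2, so that [a n < u] already for n = 0. *)
pose a n : R := u / n.+2%:R.
have a0 n : 0 < a n by rewrite divr_gt0.
have au n : a n < u by rewrite ltr_pdivrMr// ltr_pMr// ltr1n.
pose F n : set R := `[a n, u]%classic.
have UF : `]0, u]%classic = \bigcup_n F n.
  apply/seteqP; split=> [z /= |z [n _]].
    rewrite in_itv/= => /andP[z0 zu].
    have [n nz] : exists n, u / z < n%:R.
      by exists (Num.bound (u / z)); apply: archi_boundP; rewrite divr_ge0// ltW.
    exists n => //; rewrite /F /= in_itv/= zu andbT ler_pdivrMr//.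
    rewrite mulrC -ler_pdivrMr// (le_trans (ltW nz))// ler_nat.
    by rewrite (leq_trans (leqnSn _)).
  rewrite /F /= !in_itv/= => /andP[az ->].
  by rewrite andbT (lt_le_trans (a0 n)).
have intF n : (\int[mu]_(z in F n) (z `^ p)%:E =
    ((u `^ (p + 1) - a n `^ (p + 1)) / (p + 1))%:E)%E.
  have dP (x : R) : 0 < x -> is_derive x 1 (fun x => x `^ (p + 1) / (p + 1)) (x `^ p).
    move=> x0.
    have dx : derivable (@powR R ^~ (p + 1)) x 1.
      by apply: derivable_powR; rewrite in_itv/= x0.
    apply: DeriveDef; first exact: derivableM.
    rewrite deriveM// derive_cst scaler0 add0r -derive1E powR_derive1 ?in_itv/= ?x0//.
    by rewrite addrK /GRing.scale/=; field; rewrite gt_eqF.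
  have dF (x : R) : 0 < x -> derivable (fun x => x `^ (p + 1) / (p + 1)) x 1.
    by move=> /dP[].
  have cF (x : R) : 0 < x -> {for x, continuous (fun x => x `^ (p + 1) / (p + 1))}.
    by move=> /dF dFx; apply: differentiable_continuous; exact/derivable1_diffP.
  rewrite (@continuous_FTC2 _ _ (fun x => x `^ (p + 1) / (p + 1)))//.
  - by rewrite -EFinB mulrBl.
  - apply: derivable_within_continuous => x; rewrite in_itv/= => /andP[ax _].
    by apply: derivable_powR; rewrite in_itv/= andbT (lt_le_trans (a0 n)).
  - split.
    + by move=> x; rewrite in_itv/= => /andP[ax _]; apply: dF; exact: lt_trans ax.
    + by apply: cvg_at_right_filter; exact: cF.
    + by apply: cvg_at_left_filter; exact: cF.
  - move=> x; rewrite in_itv/= => /andP[ax _]; rewrite derive1E.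
    by have /dP dx := lt_trans (a0 n) ax; rewrite derive_val.
have cvg1 : ((\int[mu]_(z in F n) (z `^ p)%:E) @[n --> \oo] -->
    \int[mu]_(z in \bigcup_n F n) (z `^ p)%:E)%E.
  apply: ge0_nondecreasing_set_cvg_integral => //.
  - move=> m n mn; apply/subsetPset => z; rewrite /F /= !in_itv/= => /andP[az ->].
    rewrite andbT (le_trans _ az)// ler_pM2l// lef_pV2 ?posrE//.
    by rewrite ler_nat !ltnS.
  - by move=> n; exact: measurable_itv.
  - by move=> n; apply/measurable_EFinP/measurable_funTS; exact: measurable_powR.
  - by move=> n x _; rewrite lee_fin powR_ge0.
have cvg2 : (((u `^ (p + 1) - a n `^ (p + 1)) / (p + 1))%:E @[n --> \oo] -->
    (u `^ (p + 1) / (p + 1))%:E)%E.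
  apply: cvg_EFin; first by near=> n.
  have {2}-> : u `^ (p + 1) = u `^ (p + 1) - 0 by rewrite subr0.
  apply: cvgM; last exact: cvg_cst.
  apply: cvgB; first exact: cvg_cst.
  have a_0 : a n @[n --> \oo] --> (0 : R).
    rewrite -[X in _ --> X](mulr0 u); apply: cvgM; first exact: cvg_cst.
    by have := @cvg_harmonic R; rewrite -cvg_shiftS.
  by have /cvg_at_rightP := powR_cvg0 p10; apply; split.
rewrite (funext intF) in cvg1.
by rewrite UF; exact: (cvg_unique _ cvg1 cvg2).
Unshelve. all: by end_near. Qed.

Lemma integral_expRN_ge (t : R) :
  (\int[mu]_(u in `[t, +oo[) (expR (- u))%:E = (expR (- t))%:E)%E.
Proof.
have dF (x : R) : is_derive x 1 (fun x => - expR (- x)) (expR (- x)).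
  by apply: is_derive_eq; rewrite mulrN1 opprK.
rewrite (@ge0_continuous_FTC2y _ _ (fun x => - expR (- x)) _ 0).
- by rewrite EFinN oppeK add0e.
- by move=> x _; exact: expR_ge0.
- by apply: derivable_within_continuous => x _; exact: ex_derive.
- by rewrite -oppr0; apply: cvgN; exact: cvgr_expR.
- by move=> x _; exact: ex_derive.
- have : {for t, continuous (fun x : R => - expR (- x))}.
    apply: differentiable_continuous; apply/derivable1_diffP.
    by have [] := dF t.
  by move=> ?; exact: cvg_at_right_filter.
- by move=> x _; rewrite derive1E derive_val.
Qed.


(** The Gamma integral kept in the extended reals: Tonelli and the recursion apply to it before
    finiteness is known. *)
Definition Gamma_ereal (x : R) : \bar R :=
  (\int[mu]_(t in `]0%R, +oo[) (t `^ (x - 1) * expR (- t))%:E)%E.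

Lemma GammaE (x : R) : Gamma x = fine (Gamma_ereal x).
Proof. by []. Qed.

(* Layer cake: write exp(-c z^q) as the integral of exp(-u) over u >= c z^q and
   exchange the integrals. *)
Lemma integral_powR_expR p q c : -1 < p -> 0 < q -> 0 < c ->
  (\int[mu]_(z in `]0%R, +oo[) (z `^ p * expR (- (c * z `^ q)))%:E =
   ((p + 1) * c `^ ((p + 1) / q))^-1%:E * Gamma_ereal ((p + 1) / q + 1))%E.
Proof.
move=> p1 q0 c0; have p10 : 0 < p + 1 by rewrite -ltrBlDr sub0r.
pose f (x : R * R) : \bar R :=
  (if (0 < x.1) && (c * x.1 `^ q <= x.2) then x.1 `^ p * expR (- x.2) else 0)%:E.
have mf : measurable_fun setT f.
  apply/measurable_EFinP; apply: measurable_fun_ifT => //.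
    apply: measurable_and; first exact: measurable_fun_ltr.
    apply: measurable_fun_ler => //; apply: measurable_funM => //.
    by apply: (measurableT_comp (measurable_powR _)).
  apply: measurable_funM.
    by apply: (measurableT_comp (measurable_powR _)).
  by apply: measurableT_comp => //; apply: measurableT_comp.
have f0 (z : R * R) : (0 <= f z)%E.
  by rewrite lee_fin; case: ifP => // _; rewrite mulr_ge0 ?powR_ge0 ?expR_ge0.
have L z : (\int[mu]_u f (z, u) =
    if (0 < z)%R then (z `^ p * expR (- (c * z `^ q)))%:E else 0)%E.
  rewrite /f /=; case: ifPn => z0 /=; last by rewrite integral0.
  rewrite EFinM -integral_expRN_ge -ge0_integralZl_fin ?powR_ge0//; last by apply: measurableT_comp.
  rewrite (integral_if mu (fun u => u \in `[c * z `^ q, +oo[)).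
  by apply: eq_integral => u _; rewrite in_itv/= andbT; case: ifP.
have r1 (u z : R) : 0 < u -> (0 < z) && (c * z `^ q <= u) =
    (z \in `]0, (u / c) `^ q^-1]).
  move=> u0; rewrite in_itv/=.
  case: (ltP 0 z) => //= z0.
  rewrite mulrC -ler_pdivlMr//.
  have uc : 0 <= u / c by rewrite divr_ge0 ?ltW.
  apply/idP/idP => H.
    have := @ge0_ler_powR _ q^-1 _ (z `^ q) (u / c).
    rewrite -powRrM divff ?gt_eqF// powRr1 ?(ltW z0)//; apply => //.
    - by rewrite invr_ge0 ltW.
    - by rewrite nnegrE powR_ge0.
  have := @ge0_ler_powR _ q _ z ((u / c) `^ q^-1).
  rewrite -powRrM mulVf ?gt_eqF// powRr1//; apply => //.
  - exact: ltW.
  - by rewrite nnegrE ltW.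
  - by rewrite nnegrE powR_ge0.
have G u : (\int[mu]_z f (z, u) =
    if (0 < u)%R then (expR (- u) * (((u / c) `^ q^-1) `^ (p + 1) / (p + 1)))%:E
    else 0)%E.
  case: ifPn => u0; last first.
    rewrite integral0_eq// => z _; rewrite /f /=; case: ifP => // /andP[z0].
    by move/(lt_le_trans (mulr_gt0 c0 (powR_gt0 q z0))); rewrite (negbTE u0).
  rewrite EFinM -integral_powR ?powR_ge0// -ge0_integralZl_fin ?expR_ge0//; last by move=> z; exact: powR_ge0.
  rewrite (integral_if mu (fun z => z \in `]0, (u / c) `^ q^-1])).
  by apply: eq_integral => z _; rewrite /f/= -r1//; case: ifP => // _; rewrite mulrC.
rewrite integral_itv0y; under eq_integral do rewrite -L.
rewrite -/(fubini_F mu f) fubini_tonelli//; under eq_integral do rewrite /fubini_G/= G.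
rewrite /Gamma_ereal -ge0_integralZl_fin ?invr_ge0 ?mulr_ge0 ?powR_ge0 ?ltW//; last 2 first.
- apply: measurable_funM; first exact: measurable_powR.
  by apply: measurableT_comp.
- by move=> z; rewrite mulr_ge0 ?powR_ge0 ?expR_ge0.
rewrite integral_itv0y; apply: eq_integral => u _; case: ifPn => // u0.
congr EFin; rewrite addrK -powRrM [q^-1 * _]mulrC.
rewrite powRM ?invr_ge0 ?ltW//.
have -> e : (c^-1) `^ e = (c `^ e)^-1.
  by rewrite -[c^-1]powR_inv1 ?ltW// -powRrM mulN1r powRN.
field.
by rewrite !gt_eqF// powR_gt0.
Qed.

Lemma Gamma_ereal_ge0 (x : R) : (0 <= Gamma_ereal x)%E.
Proof.
by apply: integral_ge0 => t _; rewrite lee_fin mulr_ge0 ?powR_ge0 ?expR_ge0.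
Qed.

(** The case p = x - 1, q = c = 1 of [integral_powR_expR]; the layer-cake argument stands in for
    integration by parts. Being an identity of extended reals, it can serve to prove finiteness. *)
Lemma Gamma_ereal_rec (x : R) : 0 < x -> Gamma_ereal (x + 1) = (x%:E * Gamma_ereal x)%E.
Proof.
move=> x0; have := @integral_powR_expR (x - 1) 1 1.
rewrite subrK powR1 mulr1 divr1 => /(_ _ ltr01 ltr01) H.
rewrite [in RHS]/Gamma_ereal.
transitivity (x%:E * (x^-1%:E * Gamma_ereal (x + 1)))%E.
  by rewrite muleA -EFinM divff ?gt_eqF// mul1e.
rewrite -H; last by rewrite ltrBrDr addNr.
congr (_ * _)%E; apply: eq_integral => t; rewrite inE/= in_itv/= andbT => t0.
by rewrite mul1r powRr1 ?ltW.
Qed.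

Lemma Gamma_ereal1 : Gamma_ereal 1 = 1%E.
Proof.
rewrite /Gamma_ereal integral_itv_obnd_cbnd; last first.
  apply: measurable_funTS; apply/measurable_EFinP; apply: measurable_funM.
    exact: measurable_powR.
  by apply: measurableT_comp.
under eq_integral do rewrite subrr powRr0 mul1r.
by rewrite integral_expRN_ge oppr0 expR0.
Qed.

(** Positive integers follow by recursion from Gamma(1) = 1. For y >= 1, t^(y-1) <= 1 + t^n with an
    integer n >= y bounds the integral by two integer values. The remaining x > 0 come from Gamma(x)
    = Gamma(x + 1) / x. *)
Lemma Gamma_ereal_fin (x : R) : 0 < x -> Gamma_ereal x \is a fin_num.
Proof.
have fin_nat n : Gamma_ereal n.+1%:R \is a fin_num.
  elim: n => [|n IH]; first by rewrite Gamma_ereal1.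
  by rewrite -[n.+2%:R]natr1 Gamma_ereal_rec// fin_numM.
have mg y : measurable_fun setT (fun t : R => (t `^ (y - 1) * expR (- t))%:E).
  apply/measurable_EFinP; apply: measurable_funM; first exact: measurable_powR.
  by apply: measurableT_comp.
have g0 y (t : R) : (0 <= (t `^ (y - 1) * expR (- t))%:E)%E.
  by rewrite lee_fin mulr_ge0 ?powR_ge0 ?expR_ge0.
have fin1 y : 1 <= y -> Gamma_ereal y \is a fin_num.
  move=> y1; have y0 : 0 <= y by rewrite (le_trans _ y1).
  rewrite ge0_fin_numE ?Gamma_ereal_ge0//.
  apply: (@le_lt_trans _ _ (Gamma_ereal 1 + Gamma_ereal (Num.bound y).+1%:R))%E.
    rewrite /Gamma_ereal -ge0_integralD//=; try by [].
    all: try (by apply: measurable_funTS; exact: mg).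
    apply: ge0_le_integral => //=.
    all: try (by apply: measurable_funTS; exact: mg).
    by apply: emeasurable_funD; apply: measurable_funTS; exact: mg.
    move=> t; rewrite in_itv/= andbT => t0; rewrite -EFinD lee_fin.
    rewrite -mulrDl ler_pM2r ?expR_gt0// subrr powRr0.
    have [t1|t1] := leP t 1.
      rewrite (@le_trans _ _ 1)// ?lerDl ?powR_ge0//.
      have := @ge0_ler_powR _ (y - 1) _ t 1; rewrite powR1; apply => //.
      - by rewrite subr_ge0.
      - by rewrite nnegrE ltW.
      - by rewrite nnegrE.
    rewrite (@le_trans _ _ (t `^ ((Num.bound y).+1%:R - 1)))//; last by rewrite lerDr.
    apply: ler_powR; first exact: ltW.
    rewrite lerD2r -natr1 (le_trans (ltW (archi_boundP y0)))// lerDl//.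
  by rewrite lte_add_pinfty// ?Gamma_ereal1 ?ltry// ltey_eq fin_nat.
move=> x0; have := fin1 (x + 1); rewrite lerDr => /(_ (ltW x0)).
rewrite Gamma_ereal_rec// => H.
have -> : Gamma_ereal x = (x^-1%:E * (x%:E * Gamma_ereal x))%E.
  by rewrite muleA -EFinM mulVf ?gt_eqF// mul1e.
by rewrite fin_numM.
Qed.

Lemma EFin_Gamma (x : R) : 0 < x -> (Gamma x)%:E = Gamma_ereal x.
Proof. by move=> x0; rewrite GammaE fineK// Gamma_ereal_fin. Qed.

Lemma Gamma_rec (x : R) : 0 < x -> Gamma (x + 1) = x * Gamma x.
Proof.
move=> x0; apply: EFin_inj.
by rewrite EFinM !EFin_Gamma// ?Gamma_ereal_rec// addr_gt0.
Qed.

(** On ]0, 1] the integrand is at least e^(-1) t^(x-1), whose integral there is e^(-1) / x. *)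
Lemma Gamma_gt0 (x : R) : 0 < x -> 0 < Gamma x.
Proof.
move=> x0; rewrite -lte_fin EFin_Gamma//.
have e1 : 0 < expR (-1) / x by rewrite divr_gt0 ?expR_gt0.
apply: (@lt_le_trans _ _ (expR (-1) / x)%:E); first by rewrite lte_fin.
have -> : (expR (-1) / x)%:E =
    ((expR (-1))%:E * \int[mu]_(t in `]0%R, 1%R]) (t `^ (x - 1))%:E)%E.
  by rewrite integral_powR// ?ltrBrDr ?addNr// -EFinM powR1 subrK div1r.
rewrite -ge0_integralZl_fin ?expR_ge0//; last by move=> z; exact: powR_ge0.
have mg : measurable_fun setT (fun t : R => (t `^ (x - 1) * expR (- t))%:E).
  apply/measurable_EFinP; apply: measurable_funM; first exact: measurable_powR.
  by apply: measurableT_comp.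
apply: (@le_trans _ _
    (\int[mu]_(t in `]0%R, 1%R]) (t `^ (x - 1) * expR (- t))%:E)%E).
  apply: ge0_le_integral => //=.
  - by move=> t _; rewrite lee_fin mulr_ge0 ?expR_ge0 ?powR_ge0.
  - apply/measurable_EFinP; apply: measurable_funTS; apply: measurable_funM => //.
  - exact: measurable_funTS.
  - move=> t; rewrite in_itv/= => /andP[_ t1].
    by rewrite lee_fin mulrC ler_wpM2l ?powR_ge0// ler_expR lerN2.
apply: ge0_subset_integral => //=.
- exact: measurable_funTS.
- by move=> t _; rewrite lee_fin mulr_ge0 ?powR_ge0 ?expR_ge0.
- by move=> t /=; rewrite !in_itv/= andbT => /andP[].
Qed.

End gamma.

(** * Positive normal moments and exchangeability of correlated normal pairs *)

Section bivariate_normal.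
Context {R : realType}.
Implicit Types (p r s c : R).
Local Notation mu := (@lebesgue_measure R).
Local Notation phi := (@normal_pdf R 0 1).
Local Notation N01 := (@normal_prob R 0 1).
Local Notation kappa := (@normal_peak R 1).

Lemma normal_pdf01E (x : R) : phi x = kappa * expR (- (2^-1 * x ^+ 2)).
Proof.
rewrite normal_pdfE ?oner_eq0// /normal_fun subr0 expr1n; congr (_ * expR _).
by field.
Qed.

Lemma normal_peak1_gt0 : 0 < kappa.
Proof. by rewrite normal_peak_gt0// oner_eq0. Qed.

Lemma normal_peak1_sqr : kappa ^+ 2 = (2 * pi)^-1.
Proof.
have pi2 : 0 <= pi *+ 2 :> R by rewrite mulrn_wge0// pi_ge0.
by rewrite /normal_peak expr1n mul1r exprVn sqr_sqrtr// mulr_natl.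
Qed.

Lemma ge0_integral_normal (f : R -> \bar R) :
  measurable_fun setT f -> (forall x, 0 <= f x)%E ->
  (\int[N01]_x f x = \int[mu]_x (f x * (phi x)%:E))%E.
Proof.
move=> mf f0; apply: ge0_integral_density => //; first exact: measurable_normal_pdf.
by move=> x; exact: normal_pdf_ge0.
Qed.

Lemma normal_pdfN (x : R) : phi (- x) = phi x.
Proof. by rewrite !normal_pdf01E sqrrN. Qed.

Lemma ge0_integral_normal_opp (f : R -> \bar R) :
  measurable_fun setT f -> (forall x, 0 <= f x)%E ->
  (\int[N01]_x f (- x)%R = \int[N01]_x f x)%E.
Proof.
move=> mf f0.
rewrite !ge0_integral_normal//; last by apply: measurableT_comp.
rewrite -[RHS]ge0_integral_opp//.
- by apply: eq_integral => x _; rewrite normal_pdfN.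
- apply: emeasurable_funM => //; apply/measurable_EFinP.
  exact: measurable_normal_pdf.
- by move=> x; rewrite mule_ge0// lee_fin normal_pdf_ge0.
Qed.

(** Closed form of E[Z_+^p], with 1 / sqrt (2 pi) kept as [kappa]. *)
Definition moment_const p := kappa * (2 `^ ((p - 1) / 2) * Gamma ((p + 1) / 2)).

Lemma moment_const_gt0 p : 0 < p -> 0 < moment_const p.
Proof.
move=> p0; rewrite mulr_gt0 ?normal_peak1_gt0// mulr_gt0 ?powR_gt0//.
by rewrite Gamma_gt0// divr_gt0// addr_gt0.
Qed.

(** The Gamma recursion at (p + 1) / 2. At p = nu it is the source of the factor nu + 1 in
    [gamma_const]. *)
Lemma moment_constSS p : 0 < p -> moment_const (p + 2) = (p + 1) * moment_const p.
Proof.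
move=> p0; rewrite /moment_const.
have -> : (p + 2 + 1) / 2 = (p + 1) / 2 + 1 by field.
have -> : (p + 2 - 1) / 2 = (p - 1) / 2 + 1 by field.
rewrite Gamma_rec ?divr_gt0 ?addr_gt0// powRD ?pnatr_eq0 ?implybT// powRr1//.
by field.
Qed.

Lemma integral_powR_gauss p c : -1 < p -> 0 < c ->
  (\int[mu]_(z in `]0%R, +oo[) (z `^ p * expR (- (c * z ^+ 2)))%:E =
   ((2 * c `^ ((p + 1) / 2))^-1 * Gamma ((p + 1) / 2))%:E)%E.
Proof.
move=> p1 c0; have p10 : 0 < p + 1 by rewrite -ltrBlDr sub0r.
transitivity (\int[mu]_(z in `]0%R, +oo[) (z `^ p * expR (- (c * z `^ 2)))%:E)%E.
  apply: eq_integral => z; rewrite inE/= in_itv/= andbT => z0.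
  by rewrite powR_mulrn// ltW.
rewrite integral_powR_expR// Gamma_ereal_rec ?divr_gt0// -EFin_Gamma ?divr_gt0//.
rewrite -!EFinM; congr EFin; field.
by rewrite !gt_eqF// powR_gt0.
Qed.

(** For [powR], 0 to the power 0 is 1; a nonzero exponent is what makes the power vanish for z <=
    0. *)
Lemma max0_powR p (z : R) : p != 0 ->
  (Num.max z 0) `^ p = if 0 < z then z `^ p else 0.
Proof.
by move=> p0; case: ltP => // z0; rewrite powR0.
Qed.

Lemma measurable_max0_powR p : measurable_fun setT (fun z : R => (Num.max z 0) `^ p).
Proof.
apply: (measurableT_comp (measurable_powR p)).
exact: measurable_maxr.
Qed.

Lemma normal_pos_momentE p : 0 < p ->
  (\int[N01]_z ((Num.max z 0) `^ p)%:E = (moment_const p)%:E)%E.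
Proof.
move=> p0; rewrite ge0_integral_normal; last 2 first.
- by apply/measurable_EFinP; exact: measurable_max0_powR.
- by move=> x; rewrite lee_fin powR_ge0.
transitivity (kappa%:E * \int[mu]_(z in `]0%R, +oo[)
    (z `^ p * expR (- (2^-1 * z ^+ 2)))%:E)%E.
  rewrite -ge0_integralZl_fin//; last 3 first.
  - apply: measurable_funM; first exact: measurable_powR.
    apply: measurableT_comp => //; apply: measurableT_comp => //.
    by apply: measurable_funM => //; exact: measurable_funX.
  - by move=> z; rewrite mulr_ge0 ?powR_ge0 ?expR_ge0.
  - exact: ltW normal_peak1_gt0.
  rewrite integral_itv0y; apply: eq_integral => z _.
  rewrite max0_powR ?gt_eqF// normal_pdf01E -EFinM; case: ifP => _; last by rewrite mul0r.
  by congr EFin; ring.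
rewrite integral_powR_gauss ?invr_gt0//; last by rewrite (lt_trans _ p0)// ltrN10.
rewrite -EFinM /moment_const; congr (kappa * (_ * _))%:E.
have -> : (p - 1) / 2 = (p + 1) / 2 - 1 by field.
rewrite powRB ?pnatr_eq0 ?implybT// powRr1// invfM mulrC; congr (_ / _).
by rewrite -[2^-1]powR_inv1// -powRrM mulN1r powRN invrK.
Qed.

Lemma fine_normal_pos_moment p : 0 < p -> normal_pos_moment p = moment_const p.
Proof.
by move=> p0; rewrite /normal_pos_moment unlock normal_pos_momentE.
Qed.

(* The joint density of (Z1, r Z1 + s Z2) is
   exp(-(x^2 - 2 r x y + y^2)/(2 s^2))/(2 pi s), a symmetric function of (x, y). *)
Lemma normal_rotation_sym r s (h : R * R -> \bar R) :
  0 < s -> r ^+ 2 + s ^+ 2 = 1 -> measurable_fun setT h ->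
  (forall z, 0 <= h z)%E ->
  (\int[N01]_x \int[N01]_z h (x, r * x + s * z)%R =
   \int[N01]_x \int[N01]_z h (r * x + s * z, x)%R)%E.
Proof.
move=> s0 rs mh h0.
have mphi : measurable_fun setT phi by exact: measurable_normal_pdf.
have mphi2 : measurable_fun setT (fun z : R * R => phi ((z.2 - r * z.1) / s)).
  apply: measurableT_comp => //; apply: measurable_funM => //.
  by apply: measurable_funB => //; exact: measurable_funM.
pose k (x y : R) := s^-1 * (phi x * phi ((y - r * x) / s)).
have k0 x y : 0 <= k x y.
  apply: mulr_ge0; first by rewrite invr_ge0 ltW.
  by apply: mulr_ge0; exact: normal_pdf_ge0.
have kC x y : k x y = k y x.
  rewrite /k !normal_pdf01E; congr (_ * _).
  rewrite mulrACA [RHS]mulrACA -!expRD; congr (_ * expR _).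
  have s1 : s != 0 by rewrite gt_eqF.
  apply/eqP; rewrite -subr_eq0.
  (* The two exponents differ by a multiple of 1 - (r^2 + s^2), which is zero. *)
  have -> : - (2^-1 * x ^+ 2) - 2^-1 * ((y - r * x) / s) ^+ 2 -
      (- (2^-1 * y ^+ 2) - 2^-1 * ((x - r * y) / s) ^+ 2) =
      (x ^+ 2 - y ^+ 2) * (1 - (r ^+ 2 + s ^+ 2)) / (2 * s ^+ 2) by field.
  by rewrite rs subrr mulr0 mul0r.
have mk : measurable_fun setT (fun z : R * R => (k z.1 z.2)%:E).
  apply/measurable_EFinP; apply: measurable_funM => //.
  by apply: measurable_funM => //; apply: measurableT_comp.
(* The substitution y = r x + s z in the inner integral produces the joint density [k]. *)
have rot (g : R * R -> \bar R) : measurable_fun setT g -> (forall z, 0 <= g z)%E ->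
    (\int[N01]_x \int[N01]_z g (x, r * x + s * z)%R =
     \int[mu]_x \int[mu]_y (g (x, y) * (k x y)%:E))%E.
  move=> mg g0.
  have mgs : measurable_fun setT (fun z : R * R => g (z.1, r * z.1 + s * z.2)).
    apply: measurableT_comp => //; apply: measurable_fun_pair => //.
    by apply: measurable_funD; exact: measurable_funM.
  have mgk : measurable_fun setT (fun z : R * R => g z * (k z.1 z.2)%:E)%E.
    by apply: emeasurable_funM.
  rewrite ge0_integral_normal; last 2 first.
  - exact: (measurable_fun_fubini_tonelli_F (m2 := N01) _ mgs).
  - by move=> x; exact: integral_ge0.
  apply: eq_integral => x _.
  rewrite ge0_integral_normal//; last exact: (measurableT_comp mgs (pair1_measurable x)).
  pose G y := (g (x, y) * (k x y)%:E)%E.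
  have mG : measurable_fun setT G by exact: (measurableT_comp mgk (pair1_measurable x)).
  have G0 y : (0 <= G y)%E by rewrite mule_ge0// lee_fin.
  have <- : (s%:E * \int[mu]_z G (s * z + r * x)%R)%E = (\int[mu]_y G y)%E.
    by rewrite ge0_integral_affine// muleA -EFinM divff ?gt_eqF// mul1e.
  rewrite -ge0_integralZl//; last 2 first.
  - apply: (measurableT_comp mG); apply: (@measurable_funD _ _ _ _ ( *%R s)).
      exact: measurable_funM.
    exact: measurable_cst.
  - by rewrite lee_fin ltW.
  rewrite -ge0_integralZr//; last 3 first.
  - apply: emeasurable_funM; first exact: (measurableT_comp mgs (pair1_measurable x)).
    exact/measurable_EFinP.
  - by move=> z _; rewrite mule_ge0// lee_fin normal_pdf_ge0.
  - by rewrite lee_fin normal_pdf_ge0.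
  apply: eq_integral => z _; rewrite /G /k -muleA [RHS]muleCA -!EFinM.
  rewrite [(s * z + r * x)%R]addrC; congr (_ * EFin _)%E.
  have -> : (r * x + s * z - r * x) / s = z by field; rewrite gt_eqF.
  by field; rewrite gt_eqF.
have mswap : measurable_fun setT (fun z : R * R => h (z.2, z.1)).
  by apply: measurableT_comp => //; apply: measurable_fun_pair.
rewrite rot// (rot (fun z => h (z.2, z.1)))//=.
have mhk : measurable_fun setT (fun z : R * R => h z * (k z.1 z.2)%:E)%E.
  by apply: emeasurable_funM.
rewrite (fubini_tonelli (m1 := mu) (m2 := mu) _ mhk)/=; last first.
  by move=> z; rewrite mule_ge0// lee_fin.
by apply: eq_integral => x _; apply: eq_integral => y _; rewrite /= kC.
Qed.

End bivariate_normal.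

(** * The tail coefficient of the t-copula as a normal moment *)

Section tail_coefficient.
Context {R : realType}.
Implicit Types (p r s c : R).
Local Notation mu := (@lebesgue_measure R).
Local Notation phi := (@normal_pdf R 0 1).
Local Notation N01 := (@normal_prob R 0 1).
Local Notation kappa := (@normal_peak R 1).

(** This is E[Z_+^p 1(Z' >= c Z)] for independent standard normal Z and Z', with Z' already
    integrated out. *)
Definition tail_moment p c : \bar R :=
  (\int[N01]_z (((Num.max z 0) `^ p)%:E * N01 `[(c * z)%R, +oo[))%E.

(** Unnormalised upper tail of the t-distribution with p + 1 degrees of freedom, its argument
    divided by sqrt (p + 1). *)
Definition student_tail p c : \bar R :=
  (\int[mu]_(t in `[c, +oo[) ((1 + t ^+ 2) `^ (- (p / 2 + 1)))%:E)%E.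

Lemma itvcyE (a z : R) : (z \in `[a, +oo[) = (a <= z).
Proof. by rewrite in_itv/= andbT. Qed.

Lemma normal_prob_itvcy (a : R) :
  (N01 `[a, +oo[ = \int[mu]_z (if (a <= z)%R then (phi z)%:E else 0))%E.
Proof.
rewrite /normal_prob (integral_if mu (fun z => z \in `[a, +oo[)).
by apply: eq_integral => z _; rewrite itvcyE.
Qed.

Lemma normal_prob_itvoy (a : R) : (N01 `]a, +oo[ = N01 `[a, +oo[)%E.
Proof.
rewrite /normal_prob integral_itv_obnd_cbnd//; apply: measurable_funTS.
by apply/measurable_EFinP; exact: measurable_normal_pdf.
Qed.

(** The substitution w = z t frees the domain of integration from z, which prepares the exchange of
    integrals in [tail_momentE]. *)
Lemma normal_prob_itvcy_scale (c z : R) : 0 < z ->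
  (N01 `[(c * z)%R, +oo[ =
   \int[mu]_t (if (c <= t)%R then (z * phi (z * t))%:E else 0))%E.
Proof.
move=> z0; rewrite normal_prob_itvcy.
pose f (w : R) : \bar R := (if (c * z <= w)%R then phi w else 0)%:E.
have mf : measurable_fun setT f.
  apply/measurable_EFinP; apply: measurable_fun_ifT => //.
    exact: measurable_fun_ler.
  exact: measurable_normal_pdf.
have f0 w : (0 <= f w)%E.
  by rewrite lee_fin; case: ifP => // _; exact: normal_pdf_ge0.
transitivity (\int[mu]_w f w)%E.
  by apply: eq_integral => w _; rewrite /f; case: ifP.
have -> : (\int[mu]_w f w = z%:E * \int[mu]_t f (z * t + 0)%R)%E.
  by rewrite ge0_integral_affine// muleA -EFinM divff ?gt_eqF// mul1e.
rewrite -ge0_integralZl//; last 2 first.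
- apply: (measurableT_comp mf); apply: (@measurable_funD _ _ _ _ ( *%R z)).
    exact: measurable_funM.
  exact: measurable_cst.
- by rewrite lee_fin ltW.
apply: eq_integral => t _; rewrite /f addr0 mulrC ler_pM2l//.
by case: ifP => _; rewrite ?mule0.
Qed.

Lemma measurable_normal_tail c :
  measurable_fun setT (fun z : R => N01 `[(c * z)%R, +oo[).
Proof.
have mphi : measurable_fun setT phi by exact: measurable_normal_pdf.
pose g (x : R * R) : \bar R := (if c * x.1 <= x.2 then phi x.2 else 0)%:E.
have mg : measurable_fun setT g.
  apply/measurable_EFinP; apply: measurable_fun_ifT => //.
    by apply: measurable_fun_ler => //; exact: measurable_funM.
  exact: measurableT_comp.
have g0 (z : R * R) : (0 <= g z)%E.
  by rewrite lee_fin; case: ifP => // _; exact: normal_pdf_ge0.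
have := measurable_fun_fubini_tonelli_F (m2 := mu) _ mg g0.
apply: eq_measurable_fun => z _; rewrite normal_prob_itvcy /fubini_F.
by apply: eq_integral => w _; rewrite /g/=; case: ifP.
Qed.

Lemma measurable_student_weight p :
  measurable_fun setT (fun t : R => (1 + t ^+ 2) `^ (- (p / 2 + 1))).
Proof.
apply: (measurableT_comp (measurable_powR _)).
by apply: measurable_funD => //; exact: measurable_funX.
Qed.

(** With the ratio t of the two normals as variable, Tonelli leaves for each t >= c a Gaussian
    integral of z^(p+1) with rate (1 + t^2) / 2, which is a multiple of (1 + t^2)^(-(p/2 + 1)), the
    kernel of [student_tail]. *)
Lemma tail_momentE p c : 0 < p -> tail_moment p c =
  ((kappa ^+ 2 * 2 `^ (p / 2) * Gamma (p / 2 + 1))%:E * student_tail p c)%E.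
Proof.
move=> p0.
have mphi : measurable_fun setT phi by exact: measurable_normal_pdf.
pose f (x : R * R) : \bar R := (if (0 < x.1) && (c <= x.2) then
  x.1 `^ p * phi x.1 * (x.1 * phi (x.1 * x.2)) else 0)%:E.
have mf : measurable_fun setT f.
  apply/measurable_EFinP; apply: measurable_fun_ifT => //.
    apply: measurable_and; first exact: measurable_fun_ltr.
    exact: measurable_fun_ler.
  apply: measurable_funM.
    apply: measurable_funM; first by apply: (measurableT_comp (measurable_powR _)).
    exact: measurableT_comp.
  apply: measurable_funM => //; apply: measurableT_comp => //.
  exact: measurable_funM.
have f0 (z : R * R) : (0 <= f z)%E.
  rewrite lee_fin; case: ifP => // /andP[z0 _].
  by rewrite !mulr_ge0 ?powR_ge0 ?normal_pdf_ge0 ?ltW.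
rewrite /tail_moment ge0_integral_normal; last 2 first.
- apply: emeasurable_funM; last exact: measurable_normal_tail.
  by apply/measurable_EFinP; exact: measurable_max0_powR.
- by move=> z; rewrite mule_ge0// lee_fin powR_ge0.
have L z : (((Num.max z 0) `^ p)%:E * N01 `[(c * z)%R, +oo[ * (phi z)%:E =
    \int[mu]_t f (z, t))%E.
  rewrite /f/=; case: (ltP 0 z) => z0 /=; last first.
    by rewrite powR0 ?gt_eqF// !mul0e integral0.
  rewrite normal_prob_itvcy_scale// muleAC -EFinM.
  rewrite -ge0_integralZl//; last 3 first.
  - under eq_fun do rewrite -(fun_if (@EFin R)).
    apply/measurable_EFinP; apply: measurable_fun_ifT => //.
      exact: measurable_fun_ler.
    by apply: measurable_funM => //; apply: (measurableT_comp mphi).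
  - move=> t _; case: ifP => // _.
    by rewrite lee_fin mulr_ge0 ?normal_pdf_ge0 ?ltW.
  - by rewrite lee_fin mulr_ge0 ?powR_ge0 ?normal_pdf_ge0.
  by apply: eq_integral => t _; case: ifP => _; rewrite ?mule0.
under eq_integral do rewrite L.
rewrite (fubini_tonelli (m1 := mu) (m2 := mu) _ mf f0)/= /student_tail.
rewrite (integral_if mu (fun t => t \in `[c, +oo[)) -ge0_integralZl//; last 3 first.
- rewrite (_ : (fun _ => _) = fun t : R =>
    (if c <= t then (1 + t ^+ 2) `^ (- (p / 2 + 1)) else 0)%:E); last first.
    by apply/funext => t; rewrite itvcyE; case: ifP.
  apply/measurable_EFinP; apply: measurable_fun_ifT => //.
    exact: measurable_fun_ler.
  exact: measurable_student_weight.
- by move=> t _; case: ifP => // _; rewrite lee_fin powR_ge0.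
- have G0 : 0 < Gamma (p / 2 + 1) by rewrite Gamma_gt0// addr_gt0// divr_gt0.
  by rewrite lee_fin; apply: mulr_ge0 (ltW G0); rewrite mulr_ge0 ?powR_ge0 ?sqr_ge0.
apply: eq_integral => t _; rewrite itvcyE /fubini_G /f /=.
case: ifP => ct; last first.
  by rewrite mule0 integral0_eq// => z _; rewrite andbF.
have t1 : 0 < 1 + t ^+ 2 by rewrite ltr_pwDl// sqr_ge0.
transitivity ((kappa ^+ 2)%:E * \int[mu]_(z in `]0%R, +oo[)
    (z `^ (p + 1) * expR (- (((1 + t ^+ 2) / 2) * z ^+ 2)))%:E)%E.
  rewrite -ge0_integralZl_fin ?sqr_ge0//; last 2 first.
  - apply: measurable_funM; first exact: measurable_powR.
    apply: measurableT_comp => //; apply: measurableT_comp => //.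
    by apply: measurable_funM => //; exact: measurable_funX.
  - by move=> z; rewrite mulr_ge0 ?powR_ge0 ?expR_ge0.
  rewrite integral_itv0y; apply: eq_integral => z _; rewrite andbT.
  case: ifP => // z0; congr EFin; rewrite !normal_pdf01E.
  rewrite powRD ?(gt_eqF z0) ?implybT// powRr1 ?ltW//.
  have -> : - ((1 + t ^+ 2) / 2 * z ^+ 2) =
    - (2^-1 * z ^+ 2) - 2^-1 * (z * t) ^+ 2 by field.
  by rewrite expRD; ring.
rewrite integral_powR_gauss ?divr_gt0//; last first.
  by rewrite (lt_trans _ (addr_gt0 p0 ltr01))// ltrN10.
rewrite -!EFinM; congr EFin.
have -> : (p + 1 + 1) / 2 = p / 2 + 1 by field.
rewrite powRM ?invr_ge0 ?(ltW t1)// powRN.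
have -> : (2^-1 : R) `^ (p / 2 + 1) = (2 * 2 `^ (p / 2))^-1.
  rewrite -[2^-1]powR_inv1// -powRrM mulN1r powRN powRD ?pnatr_eq0 ?implybT//.
  by rewrite powRr1// mulrC.
field.
by rewrite !gt_eqF// powR_gt0.
Qed.

Lemma tail_moment_le p c : 0 < p -> (tail_moment p c <= (moment_const p)%:E)%E.
Proof.
move=> p0; rewrite -normal_pos_momentE//; apply: ge0_le_integral => //.
- by move=> z _; rewrite mule_ge0// lee_fin powR_ge0.
- apply: emeasurable_funM; last exact: measurable_normal_tail.
  by apply/measurable_EFinP; exact: measurable_max0_powR.
- by apply/measurable_EFinP; exact: measurable_max0_powR.
- by move=> z _; rewrite -[leRHS]mule1 lee_wpmul2l ?lee_fin ?powR_ge0// probability_le1.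
Qed.

Lemma tail_moment_ge0 p c : (0 <= tail_moment p c)%E.
Proof. by apply: integral_ge0 => z _; rewrite mule_ge0// lee_fin powR_ge0. Qed.

Lemma tail_moment_fin p c : 0 < p -> tail_moment p c \is a fin_num.
Proof.
move=> p0; rewrite ge0_fin_numE ?tail_moment_ge0//.
by rewrite (le_lt_trans (tail_moment_le c p0))// ltry.
Qed.

Lemma student_tail_ge0 p c : (0 <= student_tail p c)%E.
Proof. by apply: integral_ge0 => t _; rewrite lee_fin powR_ge0. Qed.

(** The density is even, so the lower tail equals the upper one, and y = sqrt (p + 1) t rescales it.
    Both sides are [fine] parts of the same extended real; its finiteness is established in the
    proof of [student_cdf_tail_moment]. *)
Lemma student_cdf_tail p c : 0 < p ->
  (student_cdf (p + 1) (- (Num.sqrt (p + 1) * c))) =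
  fine ((Gamma (p / 2 + 1) / (Num.sqrt pi * Gamma ((p + 1) / 2)))%:E * student_tail p c)%E.
Proof.
move=> p0; have p10 : 0 < p + 1 by rewrite addr_gt0.
rewrite /student_cdf /Rintegral; congr fine.
set k := Num.sqrt (p + 1).
have k0 : 0 < k by rewrite sqrtr_gt0.
have k2 : k ^+ 2 = p + 1 by rewrite sqr_sqrtr// ltW.
have G0 : 0 < Gamma (p / 2 + 1) by rewrite Gamma_gt0// addr_gt0// divr_gt0.
have G1 : 0 < Gamma ((p + 1) / 2) by rewrite Gamma_gt0// divr_gt0.
have sp : 0 < Num.sqrt pi :> R by rewrite sqrtr_gt0 pi_gt0.
pose f (y : R) : \bar R := (if y <= - (k * c) then student_pdf (p + 1) y else 0)%:E.
have mf : measurable_fun setT f.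
  apply/measurable_EFinP; apply: measurable_fun_ifT => //.
    exact: measurable_fun_ler.
  apply: measurable_funM => //; apply: (measurableT_comp (measurable_powR _)).
  by apply: measurable_funD => //; apply: measurable_funM => //.
have f0 y : (0 <= f y)%E.
  rewrite lee_fin; case: ifP => // _; rewrite mulr_ge0 ?powR_ge0//.
  rewrite divr_ge0 ?mulr_ge0 ?sqrtr_ge0//.
  - by rewrite (_ : _ / 2 = p / 2 + 1) ?ltW//; field.
  - exact: ltW.
transitivity (\int[mu]_y f y)%E.
  rewrite (integral_if mu (fun y : R => y \in `]-oo, (- (k * c))%R])).
  by apply: eq_integral => y _; rewrite /f in_itv/=; case: ifP.
rewrite -ge0_integral_opp//.
have mfN : measurable_fun setT (fun y : R => f (- y)) by exact: measurableT_comp.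
have -> : (\int[mu]_y f (- y)%R = k%:E * \int[mu]_t f (- (k * t + 0))%R)%E.
  by rewrite (ge0_integral_affine _ _ mfN)// muleA -EFinM divff ?gt_eqF// mul1e.
rewrite /student_tail (integral_if mu (fun t => t \in `[c, +oo[)).
rewrite -!ge0_integralZl//; last 5 first.
- apply: (measurableT_comp mfN); apply: (@measurable_funD _ _ _ _ ( *%R k)).
    exact: measurable_funM.
  exact: measurable_cst.
- by rewrite lee_fin ltW.
- rewrite (_ : (fun _ => _) = fun t : R =>
    (if c <= t then (1 + t ^+ 2) `^ (- (p / 2 + 1)) else 0)%:E); last first.
    by apply/funext => t; rewrite itvcyE; case: ifP.
  apply/measurable_EFinP; apply: measurable_fun_ifT => //.
    exact: measurable_fun_ler.
  exact: measurable_student_weight.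
- by move=> t _; case: ifP => // _; rewrite lee_fin powR_ge0.
- by rewrite lee_fin divr_ge0 ?mulr_ge0// ltW.
apply: eq_integral => t _; rewrite itvcyE /f addr0 lerN2 ler_pM2l//.
case: ifP => _; last by rewrite !mule0.
rewrite -!EFinM; congr EFin; rewrite /student_pdf.
have -> : (- (k * t)) ^+ 2 / (p + 1) = t ^+ 2.
  by rewrite sqrrN exprMn k2 mulrAC divff ?mul1r// gt_eqF.
have -> : (p + 1 + 1) / 2 = p / 2 + 1 by field.
rewrite sqrtrM ?(ltW p10)// -/k.
by field; rewrite !gt_eqF.
Qed.

Lemma peak_powR p : kappa * 2 `^ (p / 2) = 2 `^ ((p - 1) / 2) / Num.sqrt pi.
Proof.
have -> : (p - 1) / 2 = p / 2 - 2^-1 by field.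
rewrite powRB ?pnatr_eq0 ?implybT// powR12_sqrt//.
rewrite /normal_peak expr1n mul1r -mulr_natl sqrtrM// invfM.
by ring.
Qed.

(** [tail_momentE] and [student_cdf_tail] are multiples of the same integral, and their constants
    differ by the factor [moment_const p]. *)
Lemma student_cdf_tail_moment p c : 0 < p ->
  (moment_const p * student_cdf (p + 1) (- (Num.sqrt (p + 1) * c)))%:E =
  tail_moment p c.
Proof.
move=> p0; have p10 : 0 < p + 1 by rewrite addr_gt0.
have m0 := moment_const_gt0 p0.
have G0 : 0 < Gamma (p / 2 + 1) by rewrite Gamma_gt0// addr_gt0// divr_gt0.
have G1 : 0 < Gamma ((p + 1) / 2) by rewrite Gamma_gt0// divr_gt0.
have sp : 0 < Num.sqrt pi :> R by rewrite sqrtr_gt0 pi_gt0.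
set K := Gamma (p / 2 + 1) / (Num.sqrt pi * Gamma ((p + 1) / 2)).
have E : tail_moment p c = ((moment_const p)%:E * (K%:E * student_tail p c))%E.
  rewrite tail_momentE// muleA -EFinM; congr (EFin _ * _)%E.
  rewrite /K /moment_const expr2 -[X in X * _]mulrA peak_powR.
  by field; rewrite !gt_eqF.
have Kfin : (K%:E * student_tail p c)%E \is a fin_num.
  have -> : (K%:E * student_tail p c = (moment_const p)^-1%:E * tail_moment p c)%E.
    by rewrite E [RHS]muleA -EFinM mulVf ?mul1e// gt_eqF.
  by rewrite fin_numM// tail_moment_fin.
by rewrite student_cdf_tail// EFinM fineK// E.
Qed.

(** The moment is split according to which variable is the smaller. By [normal_rotation_sym] the two
    parts are equal, whence the factor 2 in [tail_coef]. The condition x <= r x + s z says z >= c x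
    with c = sqrt (1 - r) / sqrt (1 + r), so each part is [tail_moment p c]. *)
Lemma normal_min_moment p r : 0 < p -> -1 < r < 1 ->
  (\int[N01]_x \int[N01]_z
     ((Num.max (Num.min x (r * x + Num.sqrt (1 - r ^+ 2) * z)) 0) `^ p)%:E =
   (moment_const p * tail_coef p r)%:E)%E.
Proof.
move=> p0 /andP[r1 r2].
have r1' : 0 < 1 + r by rewrite -ltrBlDl sub0r.
have r2' : 0 < 1 - r by rewrite subr_gt0.
set s := Num.sqrt (1 - r ^+ 2).
have sE : s = Num.sqrt (1 - r) * Num.sqrt (1 + r).
  by rewrite -sqrtrM ?ltW// /s; congr Num.sqrt; ring.
have s0 : 0 < s by rewrite sE mulr_gt0 ?sqrtr_gt0.
have rs : r ^+ 2 + s ^+ 2 = 1.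
  rewrite sqr_sqrtr; first by rewrite addrC subrK.
  by rewrite (_ : 1 - r ^+ 2 = (1 - r) * (1 + r)) ?mulr_ge0 ?ltW//; ring.
pose c := Num.sqrt (1 - r) / Num.sqrt (1 + r).
have cs : c * s = 1 - r.
  rewrite sE /c -[RHS]sqr_sqrtr ?ltW//.
  by field; rewrite gt_eqF ?sqrtr_gt0.
have tE : moment_const p * tail_coef p r =
    2 * (moment_const p * student_cdf (p + 1) (- (Num.sqrt (p + 1) * c))).
  rewrite /tail_coef mulrCA; congr (2 * (_ * student_cdf _ (- _))).
  by rewrite /c mulrA.
rewrite tE EFinM student_cdf_tail_moment//.
(* Ties are counted in [h] only, so that the two parts add up exactly to the power of the minimum;
   [normal_prob_itvoy] absorbs the difference between strict and large inequality. *)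
pose h (z : R * R) : \bar R := (if z.1 <= z.2 then (Num.max z.1 0) `^ p else 0)%:E.
pose h' (z : R * R) : \bar R := (if z.1 < z.2 then (Num.max z.1 0) `^ p else 0)%:E.
have mx : measurable_fun setT (fun z : R * R => (Num.max z.1 0) `^ p).
  by apply: (measurableT_comp (measurable_max0_powR p)).
have mh : measurable_fun setT h.
  apply/measurable_EFinP; apply: measurable_fun_ifT => //.
  exact: measurable_fun_ler.
have mh' : measurable_fun setT h'.
  apply/measurable_EFinP; apply: measurable_fun_ifT => //.
  exact: measurable_fun_ltr.
have h0 z : (0 <= h z)%E by rewrite lee_fin; case: ifP => // _; rewrite powR_ge0.
have h'0 z : (0 <= h' z)%E by rewrite lee_fin; case: ifP => // _; rewrite powR_ge0.
have mrot (g : R * R -> \bar R) : measurable_fun setT g ->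
    measurable_fun setT (fun z : R * R => g (z.1, r * z.1 + s * z.2)) /\
    measurable_fun setT (fun z : R * R => g (r * z.1 + s * z.2, z.1)).
  move=> mg.
  have ml : measurable_fun setT (fun z : R * R => r * z.1 + s * z.2).
    by apply: measurable_funD; exact: measurable_funM.
  by split; apply: measurableT_comp => //; exact: measurable_fun_pair.
have [mh1 _] := mrot _ mh.
have [mh1' mh2'] := mrot _ mh'.
have tail1 x : (\int[N01]_z h (x, r * x + s * z)%R =
    ((Num.max x 0) `^ p)%:E * N01 `[(c * x)%R, +oo[)%E.
  transitivity (\int[N01]_(z in `[(c * x)%R, +oo[) ((Num.max x 0) `^ p)%:E)%E.
    rewrite (integral_if N01 (fun z => z \in `[c * x, +oo[)).
    apply: eq_integral => z _; rewrite itvcyE /h/=.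
    rewrite -lerBlDl -{1}[x]mul1r -mulrBl -cs mulrAC [_ * s]mulrC ler_pM2l//.
    by case: ifP.
  by rewrite integral_cst.
have tail2 x : (\int[N01]_z h' (x, r * x + s * z)%R =
    ((Num.max x 0) `^ p)%:E * N01 `[(c * x)%R, +oo[)%E.
  transitivity (\int[N01]_(z in `](c * x)%R, +oo[) ((Num.max x 0) `^ p)%:E)%E.
    rewrite (integral_if N01 (fun z => z \in `]c * x, +oo[)).
    apply: eq_integral => z _; rewrite in_itv/= andbT /h'/=.
    rewrite -ltrBlDl -{1}[x]mul1r -mulrBl -cs mulrAC [_ * s]mulrC ltr_pM2l//.
    by case: ifP.
  by rewrite integral_cst//; congr (_ * _)%E; exact: normal_prob_itvoy.
transitivity (\int[N01]_x (\int[N01]_z h (x, r * x + s * z)%R +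
                           \int[N01]_z h' (r * x + s * z, x)%R))%E.
  apply: eq_integral => x _; rewrite -ge0_integralD//; last 2 first.
  - exact: (measurableT_comp mh1 (pair1_measurable x)).
  - exact: (measurableT_comp mh2' (pair1_measurable x)).
  apply: eq_integral => z _; rewrite /h /h' /= -EFinD; congr EFin.
  by case: ltP => _; rewrite ?addr0 ?add0r.
rewrite ge0_integralD//; last 4 first.
- by move=> x _; exact: integral_ge0.
- exact: (measurable_fun_fubini_tonelli_F (m2 := N01) _ mh1).
- by move=> x _; exact: integral_ge0.
- exact: (measurable_fun_fubini_tonelli_F (m2 := N01) _ mh2').
rewrite -(normal_rotation_sym s0 rs mh' h'0).
under eq_integral do rewrite tail1.
under [X in (_ + X)%E]eq_integral do rewrite tail2.
rewrite -/(tail_moment p c) -[tail_moment p c]fineK ?tail_moment_fin//.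
by rewrite -EFinM -EFinD mulr_natl.
Qed.

End tail_coefficient.

(** * Strict decrease of the tail coefficient in the degrees of freedom *)

Section tail_coefficient_monotone.
Context {R : realType}.
Implicit Types (p r s c : R).
Local Notation mu := (@lebesgue_measure R).
Local Notation phi := (@normal_pdf R 0 1).
Local Notation N01 := (@normal_prob R 0 1).

Lemma normal_prob_itv_gt0 (a b : R) : 0 <= a -> a < b -> (0 < N01 `[a, b[)%E.
Proof.
move=> a0 ab.
have b0 : 0 < phi b by rewrite normal_pdf01E mulr_gt0 ?normal_peak1_gt0 ?expR_gt0.
apply: (@lt_le_trans _ _ (\int[mu]_(x in `[a, b[) (phi b)%:E)%E).
  rewrite integral_cst//= lebesgue_measure_itv/= lte_fin ab -EFinB -EFinM lte_fin.
  by rewrite mulr_gt0// subr_gt0.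
apply: ge0_le_integral => //.
- by move=> x _; rewrite lee_fin ltW.
- by apply/measurable_EFinP/measurable_funTS; exact: measurable_normal_pdf.
move=> x /=; rewrite in_itv/= => /andP[ax xb].
rewrite lee_fin !normal_pdf01E ler_pM2l ?normal_peak1_gt0// ler_expR lerN2.
have x0 : 0 <= x := le_trans a0 ax.
by rewrite ler_pM2l ?invr_gt0// ler_sqr ?nnegrE ?(ltW xb) ?(le_trans x0 (ltW xb)).
Qed.

Definition normal_tail (a : R) : R := fine (N01 `[a, +oo[).

Lemma normal_tailE (a : R) : (normal_tail a)%:E = N01 `[a, +oo[.
Proof. by rewrite fineK// fin_num_measure. Qed.

Lemma normal_tail_lt (a b : R) : 0 <= a -> a < b -> normal_tail b < normal_tail a.
Proof.
move=> a0 ab; rewrite -lte_fin !normal_tailE.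
have -> : `[a, +oo[%classic = `[a, b[ `|` `[b, +oo[ :> set R.
  by rewrite -itv_bndbnd_setU// bnd_simp ltW.
rewrite measureU//; last first.
  apply/seteqP; split => // x [] /=; rewrite !in_itv/= andbT => /andP[_ xb].
  by rewrite leNgt xb.
by rewrite lteDr ?normal_prob_itv_gt0// fin_num_measure.
Qed.

Lemma normal_tail_le (a b : R) : a <= b -> normal_tail b <= normal_tail a.
Proof.
move=> ab; rewrite -lee_fin !normal_tailE; apply: le_measure; rewrite ?inE//.
by move=> x /=; rewrite !in_itv/= !andbT; exact: le_trans.
Qed.

Lemma normal_tail_ge0 (a : R) : 0 <= normal_tail a.
Proof. by rewrite -lee_fin normal_tailE measure_ge0. Qed.

(* Chebyshev's association inequality: with z0 = sqrt (p + 1), the weight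
   z^p (p + 1 - z^2), of zero mean, changes sign exactly where
   Q(c z) - Q(c z0) does. *)
Lemma tail_moment_lt p c : 0 < p -> 0 < c ->
  (tail_moment (p + 2) c < (p + 1)%:E * tail_moment p c)%E.
Proof.
move=> p0 c0; have p10 : 0 < p + 1 by rewrite addr_gt0.
have p20 : 0 < p + 2 by rewrite addr_gt0.
set z0 := Num.sqrt (p + 1).
have z0_gt0 : 0 < z0 by rewrite sqrtr_gt0.
have z02 : z0 ^+ 2 = p + 1 by rewrite sqr_sqrtr// ltW.
pose h (z : R) := normal_tail (c * z).
pose h0 := h z0.
have hE z : (h z)%:E = N01 `[(c * z)%R, +oo[ by rewrite normal_tailE.
have h_ge0 z : 0 <= h z by exact: normal_tail_ge0.
have mh : measurable_fun setT h.
  apply/measurable_EFinP; apply: eq_measurable_fun (measurable_normal_tail c).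
  by move=> z _; rewrite -hE.
pose w q (z : R) := (Num.max z 0) `^ q.
have w0 q z : 0 <= w q z by exact: powR_ge0.
have mw q : measurable_fun setT (w q) by exact: measurable_max0_powR.
pose D (z : R) := w p z * (((p + 1) - z ^+ 2) * (h z - h0)).
have D0 z : 0 <= D z.
  rewrite /D /w max0_powR ?gt_eqF//; case: ifP => [zp|_]; last by rewrite mul0r.
  apply: mulr_ge0; first exact: powR_ge0.
  have [zz|zz] := leP z z0.
    apply: mulr_ge0.
      by rewrite subr_ge0 -z02 ler_sqr ?nnegrE ?(ltW zp) ?(ltW z0_gt0).
    by rewrite subr_ge0; apply: normal_tail_le; rewrite ler_pM2l.
  apply: mulr_le0.
    by rewrite subr_le0 -z02 ler_sqr ?nnegrE ?(ltW zp) ?(ltW z0_gt0) ?(ltW zz).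
  by rewrite subr_le0; apply: normal_tail_le; rewrite ler_pM2l// ltW.
have mD : measurable_fun setT D.
  apply: measurable_funM => //; apply: measurable_funM.
    by apply: measurable_funB => //; exact: measurable_funX.
  exact: measurable_funB.
have wSS z : w (p + 2) z = z ^+ 2 * w p z.
  rewrite /w !max0_powR ?gt_eqF//; case: ifP => zp; last by rewrite mulr0.
  by rewrite powRD ?(gt_eqF zp) ?implybT// powR_mulrn ?(ltW zp)// mulrC.
have tE q : (\int[N01]_z (w q z * h z)%:E = tail_moment q c)%E.
  by apply: eq_integral => z _; rewrite EFinM hE.
have IZ (k : R) (f : R -> R) : measurable_fun setT f -> (forall z, 0 <= f z) ->
    0 <= k -> (\int[N01]_z (k * f z)%:E = k%:E * \int[N01]_z (f z)%:E)%E.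
  by move=> mf f0 k0; rewrite ge0_integralZl_fin.
have ID (f g : R -> R) : measurable_fun setT f -> (forall z, 0 <= f z) ->
    measurable_fun setT g -> (forall z, 0 <= g z) ->
    (\int[N01]_z (f z + g z)%:E = \int[N01]_z (f z)%:E + \int[N01]_z (g z)%:E)%E.
  move=> mf f0 mg g0; rewrite -ge0_integralD//.
  - by move=> z _; rewrite lee_fin.
  - exact/measurable_EFinP.
  - by move=> z _; rewrite lee_fin.
  - exact/measurable_EFinP.
have mwh q : measurable_fun setT (fun z => w q z * h z) by exact: measurable_funM.
have wh0 q z : 0 <= w q z * h z by rewrite mulr_ge0.
(* The integral of [D], expanded, with its negative terms moved across so that only nonnegative
   integrands occur. The terms in [h0] will cancel by [moment_constSS]. *)
have E : ((p + 1)%:E * tail_moment p c + h0%:E * (moment_const (p + 2))%:E =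
    ((p + 1) * h0)%:E * (moment_const p)%:E +
    (tail_moment (p + 2) c + \int[N01]_z (D z)%:E))%E.
  have mE q : 0 < q -> (moment_const q)%:E = (\int[N01]_z (w q z)%:E)%E.
    by move=> q0; rewrite -normal_pos_momentE.
  have h00 : 0 <= h0 by exact: h_ge0.
  have p1h : 0 <= (p + 1) * h0 by rewrite mulr_ge0// ltW.
  have wh1 z : 0 <= (p + 1) * (w p z * h z) by rewrite mulr_ge0// ltW.
  have wh2 z : 0 <= h0 * w (p + 2) z by rewrite mulr_ge0.
  have wh3 z : 0 <= (p + 1) * h0 * w p z by rewrite mulr_ge0.
  have wh4 z : 0 <= w (p + 2) z * h z + D z by rewrite addr_ge0.
  transitivity (\int[N01]_z ((p + 1) * (w p z * h z) + h0 * w (p + 2) z)%:E)%E.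
    rewrite ID//; [|exact: measurable_funM..].
    by rewrite !IZ ?(ltW p10)// tE mE.
  transitivity (\int[N01]_z ((p + 1) * h0 * w p z + (w (p + 2) z * h z + D z))%:E)%E.
    by apply: eq_integral => z _; rewrite /D wSS; congr EFin; ring.
  rewrite ID//; [|exact: measurable_funM|exact: measurable_funD].
  by rewrite IZ// ID// tE mE.
have ID_gt0 : (0 < \int[N01]_z (D z)%:E)%E.
  (* Strictness: on [I], away from the zeros 0 and [z0] of [D], the integrand is at least the
     positive constant [dl]. *)
  pose I : set R := `[(z0 / 4), (z0 / 2)[%classic.
  pose dl := (z0 / 4) `^ p * ((p + 1 - (z0 / 2) ^+ 2) * (h (z0 / 2) - h0)).
  have d1 : 0 < p + 1 - (z0 / 2) ^+ 2.
    by rewrite -z02 (_ : _ - _ = z0 ^+ 2 * (3 / 4)) ?mulr_gt0 ?exprn_gt0//; field.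
  have d2 : 0 < h (z0 / 2) - h0.
    rewrite subr_gt0; apply: normal_tail_lt; first by rewrite mulr_ge0 ?divr_ge0 ?ltW.
    by rewrite ltr_pM2l// ltr_pdivrMr// ltr_pMr// ltr1n.
  have dl0 : 0 < dl by rewrite mulr_gt0 ?powR_gt0 ?divr_gt0// mulr_gt0.
  apply: (@lt_le_trans _ _ (\int[N01]_(z in I) dl%:E)%E).
    rewrite integral_cst; last exact: measurable_itv.
    apply: mule_gt0; first by rewrite lte_fin.
    apply: normal_prob_itv_gt0; first by rewrite divr_ge0 ?ltW.
    by rewrite ltr_pM2l// ltf_pV2 ?posrE// ltr_nat.
  apply: (@le_trans _ _ (\int[N01]_(z in I) (D z)%:E)%E).
    apply: ge0_le_integral => //.
    - exact: measurable_itv.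
    - by move=> z _; rewrite lee_fin ltW.
    - by apply/measurable_EFinP; exact: measurable_funTS.
    move=> z; rewrite /I /= in_itv/= => /andP[z1 z2].
    have zp : 0 < z by rewrite (lt_le_trans _ z1)// divr_gt0.
    rewrite lee_fin /D /w max_l ?(ltW zp)//; apply: ler_pM.
    - exact: powR_ge0.
    - by rewrite mulr_ge0// ltW.
    - by apply: (@ge0_ler_powR _ p); rewrite ?nnegrE ?(ltW p0) ?(ltW zp) ?divr_ge0 ?(ltW z0_gt0).
    apply: ler_pM; [exact: ltW|exact: ltW| |].
      rewrite lerD2l lerN2 ler_sqr ?nnegrE ?(ltW z2)// ?(ltW zp)//.
      by rewrite divr_ge0 ?(ltW z0_gt0).
    by rewrite lerD2r; apply: normal_tail_le; rewrite ler_pM2l// ltW.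
  apply: ge0_subset_integral => //; [exact: measurable_itv|exact/measurable_EFinP|].
  by move=> z _; rewrite lee_fin.
have f1 := tail_moment_fin c p0; have f2 := tail_moment_fin c p20.
move: E ID_gt0; rewrite moment_constSS//.
rewrite -[tail_moment p c]fineK// -[tail_moment (p + 2) c]fineK//.
case: (\int[N01]_z (D z)%:E)%E => [x| |] //.
rewrite -!EFinM -!EFinD !lte_fin => -[E] x0.
rewrite -subr_gt0; apply: lt_le_trans x0 _.
by rewrite le_eqVlt; apply/orP; left; apply/eqP; lra.
Qed.

Lemma tail_coef_ge0 p r : 0 < p -> 0 <= tail_coef p r.
Proof.
move=> p0; rewrite /tail_coef mulr_ge0// -mulrA -(pmulr_rge0 _ (moment_const_gt0 p0)).
by rewrite -lee_fin student_cdf_tail_moment// tail_moment_ge0.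
Qed.

(** Comes from [tail_moment_le]; it supplies the dominating constant in [integrable_tail_coef]. *)
Lemma tail_coef_le2 p r : 0 < p -> tail_coef p r <= 2.
Proof.
move=> p0; rewrite /tail_coef -[leRHS]mulr1 ler_pM2l// -mulrA.
rewrite -(ler_pM2l (moment_const_gt0 p0)) mulr1.
by rewrite -lee_fin student_cdf_tail_moment// tail_moment_le.
Qed.

(** This is [tail_moment_lt] divided by [moment_const (p + 2)], that is by p + 1 times
    [moment_const p]; the bounds on r make c positive. *)
Lemma tail_coef_lt p r : 0 < p -> -1 < r < 1 -> tail_coef (p + 2) r < tail_coef p r.
Proof.
move=> p0 /andP[r1 r2]; have p20 : 0 < p + 2 by rewrite addr_gt0.
have r1' : 0 < 1 + r by rewrite -ltrBlDl sub0r.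
have r2' : 0 < 1 - r by rewrite subr_gt0.
pose c := Num.sqrt (1 - r) / Num.sqrt (1 + r).
have c0 : 0 < c by rewrite divr_gt0 ?sqrtr_gt0.
have := tail_moment_lt p0 c0; rewrite -!student_cdf_tail_moment// -EFinM lte_fin.
rewrite moment_constSS// -mulrA ltr_pM2l ?addr_gt0// ltr_pM2l ?moment_const_gt0// => H.
by rewrite /tail_coef ltr_pM2l// -!mulrA.
Qed.

End tail_coefficient_monotone.

(** * The chi-square distribution function near 0 *)

Section chi_square.
Context {R : realType}.
Local Notation mu := (@lebesgue_measure R).

(** With q = nu / 2 and y = nu s^2, [rest_const nu] times s^(nu+4) is the integral of x^(q-1)
    (x/2)^2 over ]0, y] times the normalising constant of the chi-square density. *)
Definition rest_const (nu : R) : R :=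
  nu `^ (nu / 2 + 2) / (4 * (nu / 2 + 2) * (2 `^ (nu / 2) * Gamma (nu / 2))).

Lemma rest_const_ge0 (nu : R) : 0 < nu -> 0 <= rest_const nu.
Proof.
move=> nu0; have q0 : 0 < nu / 2 by rewrite divr_gt0.
rewrite divr_ge0 ?powR_ge0// mulr_ge0//; first by rewrite mulr_ge0// addr_ge0// ltW.
by rewrite mulr_ge0 ?powR_ge0// ltW// Gamma_gt0.
Qed.

(** From e^t >= 1 + t and (1 - t + t^2) (1 + t) = 1 + t^3. The coefficient 1 in place of 1/2 is
    harmless, since only the order of the remainder matters. *)
Lemma expRN_le_quadratic (t : R) : 0 <= t -> expR (- t) <= 1 - t + t ^+ 2.
Proof.
move=> t0; have t1 : 0 < 1 + t by rewrite ltr_pwDl.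
rewrite expRN; apply: (@le_trans _ _ (1 + t)^-1).
  by rewrite lef_pV2 ?posrE ?expR_gt0// expR_ge1Dx.
rewrite -[X in X <= _]mul1r ler_pdivrMr//.
rewrite (_ : _ * _ = 1 + t ^+ 3); first by rewrite lerDl exprn_ge0.
by ring.
Qed.

(** The bounds 1 - t <= e^(-t) <= 1 - t + t^2 at t = x/2 are integrated against x^(nu/2 - 1) over
    ]0, nu s^2]. The second-order term is added to [F] rather than subtracted on the other side, so
    that all terms stay nonnegative in the extended reals. *)
Lemma chi_square_cdf_expansion (nu s : R) : 0 < nu -> 0 <= s ->
  let F := chi_square_prob nu `]-oo, nu * s ^+ 2] in
  ((a_const nu * s `^ nu)%:E <=
     F + (a_const nu * b_const nu * s `^ (nu + 2))%:E)%E /\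
  (F + (a_const nu * b_const nu * s `^ (nu + 2))%:E <=
     (a_const nu * s `^ nu)%:E + (rest_const nu * s `^ (nu + 4))%:E)%E.
Proof.
move=> nu0 s0; set q := nu / 2; set y := nu * s ^+ 2.
have q0 : 0 < q by rewrite divr_gt0.
have y0 : 0 <= y by rewrite mulr_ge0 ?sqr_ge0// ltW.
have G0 : 0 < Gamma q by rewrite Gamma_gt0.
set c := (2 `^ q * Gamma q)^-1.
have c0 : 0 < c by rewrite invr_gt0 mulr_gt0 ?powR_gt0.
have mpow p : measurable_fun setT (fun x : R => x `^ p) by exact: measurable_powR.
pose J : \bar R := (\int[mu]_(x in `]0%R, y]) (x `^ (q - 1) * expR (- (x / 2)))%:E)%E.
have mJ : measurable_fun setT (fun x : R => x `^ (q - 1) * expR (- (x / 2))).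
  apply: measurable_funM; first exact: measurable_powR.
  by apply: measurableT_comp => //; apply: measurableT_comp => //; exact: measurable_funM.
have J0 (x : R) : 0 <= x `^ (q - 1) * expR (- (x / 2)).
  by rewrite mulr_ge0 ?powR_ge0 ?expR_ge0.
have FJ : chi_square_prob nu `]-oo, y] = (c%:E * J)%E.
  rewrite /chi_square_prob /J -ge0_integralZl_fin ?(ltW c0)//.
  rewrite (integral_if mu (fun x : R => x \in `]-oo, y])).
  rewrite (integral_if mu (fun x : R => x \in `]0, y])).
  apply: eq_integral => x _; rewrite !in_itv/= /chi_square_pdf.
  case: ltP => x0 /=; last by case: ifP.
  by case: ifP => // _; congr EFin; rewrite mulrC.
have powE (p : R) : 0 <= p -> y `^ p = nu `^ p * s `^ (p * 2).
  move=> p0; rewrite powRM ?sqr_ge0 ?(ltW nu0)//; congr (_ * _).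
  by rewrite -powR_mulrn// -powRrM mulrC.
have I1 : (\int[mu]_(x in `]0%R, y]) (x `^ (q - 1))%:E = (y `^ q / q)%:E)%E.
  by rewrite integral_powR// ?subrK// ltrBrDr addNr.
have I2 : (\int[mu]_(x in `]0%R, y]) (x `^ q)%:E = (y `^ (q + 1) / (q + 1))%:E)%E.
  by rewrite integral_powR// (lt_trans _ q0)// ltrN10.
have I3 : (\int[mu]_(x in `]0%R, y]) (x `^ (q + 1))%:E = (y `^ (q + 2) / (q + 2))%:E)%E.
  rewrite integral_powR// -?addrA//; last by rewrite (lt_trans (ltrN10 _))// addr_gt0.
have split2 (f g : R -> R) : measurable_fun setT f -> (forall x, 0 <= f x) ->
    measurable_fun setT g -> (forall x, 0 <= g x) ->
    (\int[mu]_(x in `]0%R, y]) (f x + g x)%:E =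
     \int[mu]_(x in `]0%R, y]) (f x)%:E + \int[mu]_(x in `]0%R, y]) (g x)%:E)%E.
  move=> mf f0 mg g0; rewrite -ge0_integralD//.
  - by move=> x _; rewrite lee_fin.
  - by apply/measurable_EFinP; exact: measurable_funTS.
  - by move=> x _; rewrite lee_fin.
  - by apply/measurable_EFinP; exact: measurable_funTS.
have le2 (f g : R -> R) : measurable_fun setT f -> (forall x, 0 <= f x) ->
    measurable_fun setT g -> (forall x, 0 < x -> f x <= g x) ->
    (\int[mu]_(x in `]0%R, y]) (f x)%:E <= \int[mu]_(x in `]0%R, y]) (g x)%:E)%E.
  move=> mf f0 mg fg; apply: ge0_le_integral => //.
  - by move=> x _; rewrite lee_fin.
  - by apply/measurable_EFinP; exact: measurable_funTS.
  - by apply/measurable_EFinP; exact: measurable_funTS.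
  by move=> x /=; rewrite in_itv/= => /andP[x0 _]; rewrite lee_fin fg.
have p0 p (x : R) : 0 <= x `^ p by exact: powR_ge0.
have h0 p (k x : R) : 0 <= k -> 0 <= k * x `^ p by move=> k0; rewrite mulr_ge0.
have mh p (k : R) : measurable_fun setT (fun x : R => k * x `^ p).
  exact: measurable_funM.
have powq (x : R) : 0 < x -> x `^ q = x `^ (q - 1) * x /\
    x `^ (q + 1) = x `^ (q - 1) * x ^+ 2.
  move=> x0; have xn : x != 0 by rewrite gt_eqF.
  have e1 : x `^ q = x `^ (q - 1) * x.
    have := @powRD _ x (q - 1) 1; rewrite xn implybT subrK powRr1 ?(ltW x0)//.
    exact.
  split => //.
  by rewrite powRD ?xn ?implybT// powRr1 ?ltW// e1 -mulrA expr2.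
have half0 : 0 <= 2^-1 :> R by [].
have quarter0 : 0 <= 4^-1 :> R by [].
have lo : ((y `^ q / q)%:E <= J + (y `^ (q + 1) / (2 * (q + 1)))%:E)%E.
  have -> : (y `^ (q + 1) / (2 * (q + 1)))%:E =
      (\int[mu]_(x in `]0%R, y]) (2^-1 * x `^ q)%:E)%E.
    rewrite ge0_integralZl_fin// I2 -EFinM; congr EFin; field.
    by rewrite gt_eqF// addr_gt0.
  rewrite -I1 /J -split2//; last by move=> x; exact: h0.
  apply: le2 => //; first exact: measurable_funD.
  move=> x x0; have [-> _] := powq x x0.
  rewrite mulrCA -mulrDr -[X in X <= _]mulr1 ler_wpM2l//.
  by rewrite -lerBlDr (le_trans _ (expR_ge1Dx _))// mulrC.
have hi : (J + (y `^ (q + 1) / (2 * (q + 1)))%:E <=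
    (y `^ q / q)%:E + (y `^ (q + 2) / (4 * (q + 2)))%:E)%E.
  have -> : (y `^ (q + 1) / (2 * (q + 1)))%:E =
      (\int[mu]_(x in `]0%R, y]) (2^-1 * x `^ q)%:E)%E.
    rewrite ge0_integralZl_fin// I2 -EFinM; congr EFin; field.
    by rewrite gt_eqF// addr_gt0.
  have -> : (y `^ (q + 2) / (4 * (q + 2)))%:E =
      (\int[mu]_(x in `]0%R, y]) (4^-1 * x `^ (q + 1))%:E)%E.
    rewrite ge0_integralZl_fin// I3 -EFinM; congr EFin; field.
    by rewrite gt_eqF// addr_gt0.
  rewrite -I1 /J -!split2//; last 2 first.
  - by move=> z; exact: h0.
  - by move=> z; exact: h0.
  apply: le2; [exact: measurable_funD|by move=> x; rewrite addr_ge0// h0|exact: measurable_funD|].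
  move=> x x0; have [-> ->] := powq x x0.
  have x20 : 0 <= x / 2 by rewrite divr_ge0// ltW.
  have := ler_wpM2l (p0 (q - 1) x) (expRN_le_quadratic x20).
  by set E := expR _; set v := x `^ _; lra.
have aE : a_const nu * s `^ nu = c * (y `^ q / q).
  rewrite powE ?(ltW q0)// /a_const -/q Gamma_rec// /c.
  have -> : q * 2 = nu by rewrite /q; field.
  have -> : q `^ q = nu `^ q / 2 `^ q.
    rewrite {1}/q powRM ?(ltW nu0)// -[2^-1]powR_inv1// -powRrM mulN1r powRN//.
  by field; rewrite !gt_eqF ?powR_gt0.
have abE : a_const nu * b_const nu * s `^ (nu + 2) = c * (y `^ (q + 1) / (2 * (q + 1))).
  rewrite powE ?addr_ge0 ?(ltW q0)// /a_const /b_const -/q Gamma_rec// /c.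
  have -> : (q + 1) * 2 = nu + 2 by rewrite /q; field.
  have -> : q `^ q = nu `^ q / 2 `^ q.
    rewrite {1}/q powRM ?(ltW nu0)// -[2^-1]powR_inv1// -powRrM mulN1r powRN//.
  rewrite [nu `^ (q + 1)]powRD ?(gt_eqF nu0) ?implybT// powRr1 ?(ltW nu0)//.
  have nuE : nu = q * 2 by rewrite /q; field.
  have : 0 < 2 `^ q :> R by exact: powR_gt0.
  move: (nu `^ q) (s `^ _) (2 `^ q) (Gamma q) G0 => A B E G G0 E0; rewrite nuE.
  by field; rewrite !gt_eqF ?powR_gt0 ?addr_gt0.
have rE : rest_const nu * s `^ (nu + 4) = c * (y `^ (q + 2) / (4 * (q + 2))).
  rewrite powE ?addr_ge0 ?(ltW q0)// /rest_const -/q /c.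
  have -> : (q + 2) * 2 = nu + 4 by rewrite /q; field.
  by field; rewrite !gt_eqF ?powR_gt0 ?addr_gt0.
have cE0 : (0 <= c%:E)%E by rewrite lee_fin ltW.
rewrite /= FJ aE abE rE !(EFinM c) -!muleDr//; last first.
  rewrite ge0_adde_def// inE; last by rewrite lee_fin divr_ge0// mulr_ge0// addr_ge0// ltW.
  by apply: integral_ge0 => x _; rewrite lee_fin.
by split; rewrite lee_pmul2l.
Qed.

End chi_square.

(** * Probabilities of the form P(S <= w U) with U independent of S *)

Section scale_mixture.
Context d (T : measurableType d) {R : realType} (P : probability T R).
Local Notation N01 := (@normal_prob R 0 1).
Local Open Scope ereal_scope.

Lemma chi_scale_cdf (nu : R) (S : T -> R) (s : R) :
  (0 < nu)%R -> (forall w, 0 < S w)%R ->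
  has_law P (fun w => nu * S w ^+ 2)%R (chi_square_prob nu) -> (0 <= s)%R ->
  P [set w | (S w <= s)%R] = chi_square_prob nu `]-oo, (nu * s ^+ 2)%R].
Proof.
move=> nu0 S0 SP s0; rewrite -SP//; congr (P _).
by apply/seteqP; split=> w /=; rewrite in_itv/= ler_pM2l// ler_sqr ?nnegrE ?(ltW (S0 w)).
Qed.

(** Given U, the probability is the distribution function of S at w U; [chi_square_cdf_expansion] at
    s = w U_+ is then integrated over U. *)
Lemma scale_mixture_expansion (nu : R) (S U : T -> R) (w : R) :
  measurable_fun setT S -> measurable_fun setT U ->
  (0 < nu)%R -> (forall t, 0 < S t)%R ->
  has_law P (fun t => nu * S t ^+ 2)%R (chi_square_prob nu) ->
  (forall A B, measurable A -> measurable B ->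
    P (U @^-1` A `&` S @^-1` B) = P (U @^-1` A) * P (S @^-1` B)) ->
  (0 < w)%R ->
  let M p := \int[P]_t ((Num.max (U t) 0%R) `^ p)%:E in
  let F := P [set t | (S t <= w * U t)%R] in
  (a_const nu * w `^ nu)%:E * M nu <=
    F + (a_const nu * b_const nu * w `^ (nu + 2))%:E * M (nu + 2)%R /\
  F + (a_const nu * b_const nu * w `^ (nu + 2))%:E * M (nu + 2)%R <=
    (a_const nu * w `^ nu)%:E * M nu +
    (rest_const nu * w `^ (nu + 4))%:E * M (nu + 4)%R.
Proof.
move=> mS mU nu0 S0 SP ind w0 M F.
pose S' : {RV P >-> R} := HB.pack S (isMeasurableFun.Build _ _ _ _ S mS).
pose U' : {RV P >-> R} := HB.pack U (isMeasurableFun.Build _ _ _ _ U mU).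
have q0 : (0 < nu / 2)%R by rewrite divr_gt0.
have a0 : (0 <= a_const nu)%R.
  by rewrite /a_const divr_ge0 ?powR_ge0// ltW// Gamma_gt0// addr_gt0.
have b0 : (0 <= b_const nu)%R.
  by rewrite /b_const divr_ge0 ?sqr_ge0// addr_ge0// ltW.
have r0 := rest_const_ge0 nu0.
pose f (x : R * R) : \bar R := (if x.2 <= w * x.1 then 1 else 0 : R)%R%:E.
have mf : measurable_fun setT f.
  apply/measurable_EFinP; apply: measurable_fun_ifT => //.
  by apply: measurable_fun_ler => //; exact: measurable_funM.
have f0 x : 0 <= f x by rewrite lee_fin; case: ifP.
have mset : measurable [set t | (S t <= w * U t)%R].
  rewrite -[X in measurable X]setTI.
  have : measurable_fun setT (fun t => S t <= w * U t)%R.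
    by apply: measurable_fun_ler => //; exact: measurable_funM.
  by move=> /(_ measurableT [set true]); apply.
have SE u : distribution P S' `]-oo, u] = P [set t | (S t <= u)%R].
  have -> : [set t | (S t <= u)%R] = S @^-1` `]-oo, u].
    by apply/seteqP; split => t /=; rewrite in_itv.
  by [].
have FE : F = \int[P]_t P [set t' | (S t' <= w * U t)%R].
  transitivity (\int[P]_t f (U' t, S' t)).
    rewrite /F -[LHS]mul1e -integral_cst//.
    rewrite (integral_if P (fun t => S t <= w * U t)%R).
    by apply: eq_integral => t _; rewrite /f/=; case: ifP.
  rewrite independent_integral//; apply: eq_integral => t _.
  transitivity (\int[distribution P S']_(v in `]-oo, (w * U t)%R]) (cst 1 v)).
    rewrite (integral_if (distribution P S') (fun v : R => v \in `]-oo, (w * U t)%R])).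
    by apply: eq_integral => v _; rewrite /f in_itv/=; case: ifP.
  by rewrite integral_cst// mul1e; exact: SE.
pose G (t : T) := P [set t' | (S t' <= w * U t)%R].
have G0 t : 0 <= G t by [].
pose V t : R := Num.max (U t) 0%R.
have V0 t : (0 <= V t)%R by rewrite /V le_max lexx orbT.
have bound t :
    ((a_const nu * w `^ nu) * V t `^ nu)%:E <=
      G t + ((a_const nu * b_const nu * w `^ (nu + 2)) * V t `^ (nu + 2))%:E /\
    G t + ((a_const nu * b_const nu * w `^ (nu + 2)) * V t `^ (nu + 2))%:E <=
      ((a_const nu * w `^ nu) * V t `^ nu)%:E +
      ((rest_const nu * w `^ (nu + 4)) * V t `^ (nu + 4))%:E.
  (* Since S is positive, the event is empty when U t < 0, and so it is after U t is replaced by its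
     positive part 0. *)
  have GE : G t = chi_square_prob nu `]-oo, (nu * (w * V t) ^+ 2)%R].
    rewrite -(chi_scale_cdf nu0 S0 SP); last by rewrite mulr_ge0// ltW.
    rewrite /G /V; case: (leP 0%R (U t)) => // U0.
    rewrite mulr0; congr (P _); apply/seteqP; split => t' /=.
      by rewrite leNgt (lt_trans _ (S0 t'))// pmulr_rlt0.
    by rewrite leNgt S0.
  have wV : (0 <= w * V t)%R by rewrite mulr_ge0// ltW.
  have [] := chi_square_cdf_expansion nu0 wV.
  by rewrite -GE !powRM ?(ltW w0)// !mulrA.
have mV p : measurable_fun setT (fun t => V t `^ p)%R.
  exact: (measurableT_comp (measurable_max0_powR p) mU).
have mG : measurable_fun setT G.
  pose c (u : R) := P [set t' | (S t' <= w * u)%R].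
  have mc : measurable_fun setT c.
    have := measurable_fun_fubini_tonelli_F (m2 := distribution P S') _ mf f0.
    apply: eq_measurable_fun => u _; rewrite /fubini_F.
    transitivity (\int[distribution P S']_(v in `]-oo, (w * u)%R]) (cst 1 v)).
      rewrite (integral_if (distribution P S') (fun v : R => v \in `]-oo, (w * u)%R])).
      by apply: eq_integral => v _; rewrite /f in_itv/=; case: ifP.
    by rewrite integral_cst// mul1e; exact: SE.
  exact: (measurableT_comp mc mU).
have IZ (k p : R) : (0 <= k)%R ->
    \int[P]_t (k * V t `^ p)%:E = k%:E * M p.
  by move=> k0; rewrite ge0_integralZl_fin// => t; exact: powR_ge0.
have mZ (k p : R) : measurable_fun setT (fun t => (k * V t `^ p)%:E).
  by apply/measurable_EFinP; exact: measurable_funM.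
have Z0 (k p : R) t : (0 <= k)%R -> 0 <= (k * V t `^ p)%:E.
  by move=> k0; rewrite lee_fin mulr_ge0 ?powR_ge0.
have k1 : (0 <= a_const nu * w `^ nu)%R by rewrite mulr_ge0 ?powR_ge0.
have k2 : (0 <= a_const nu * b_const nu * w `^ (nu + 2))%R.
  by rewrite mulr_ge0 ?powR_ge0// mulr_ge0.
have k3 : (0 <= rest_const nu * w `^ (nu + 4))%R by rewrite mulr_ge0 ?powR_ge0.
rewrite FE -!IZ// -!ge0_integralD//; try by move=> t _; exact: Z0.
split; apply: ge0_le_integral => //.
- by move=> t _; exact: Z0.
- exact: emeasurable_funD.
- by move=> t _; have [] := bound t.
- by move=> t _; rewrite adde_ge0//; exact: Z0.
- exact: emeasurable_funD.
- exact: emeasurable_funD.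
- by move=> t _; have [] := bound t.
Qed.

End scale_mixture.

(** * Independence and laws of the four variables of the mixture *)

Section mixture_independence.
Context d (T : measurableType d) {R : realType} (P : probability T R).
Variables (Z1 Z2 S rho : {RV P >-> R}).
Hypothesis indep : mutually_independent (tnth [tuple Z1; Z2; S; rho]).
Local Notation N01 := (@normal_prob R 0 1).
Local Open Scope ereal_scope.

(** Mutual independence for the full index set; subfamilies are reached by taking some of the sets
    to be [setT]. *)
Lemma independent4 (A1 A2 A3 A4 : set R) :
  measurable A1 -> measurable A2 -> measurable A3 -> measurable A4 ->
  P (Z1 @^-1` A1 `&` Z2 @^-1` A2 `&` (S @^-1` A3 `&` rho @^-1` A4)) =
  P (Z1 @^-1` A1) * P (Z2 @^-1` A2) * (P (S @^-1` A3) * P (rho @^-1` A4)).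
Proof.
move=> mA1 mA2 mA3 mA4.
pose B := tnth [tuple A1; A2; A3; A4].
have mB i : measurable (B i) by case: i => -[|[|[|[|//]]]] lti.
have := indep [set: 'I_4]%SET mB.
have -> : \bigcap_(i in [set` [set: 'I_4]%SET])
    (tnth [tuple Z1; Z2; S; rho] i @^-1` B i) =
    Z1 @^-1` A1 `&` Z2 @^-1` A2 `&` (S @^-1` A3 `&` rho @^-1` A4).
  apply/seteqP; split=> [t H|t [[t1 t2] [t3 t4]] i _]; last first.
    by case: i => -[|[|[|[|//]]]] lti.
  have H' i : (tnth [tuple Z1; Z2; S; rho] i @^-1` B i) t.
    by apply: H; rewrite /= inE.
  split; split.
  - exact: (H' (@Ordinal 4 0 isT)).
  - exact: (H' (@Ordinal 4 1 isT)).
  - exact: (H' (@Ordinal 4 2 isT)).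
  - exact: (H' (@Ordinal 4 3 isT)).
move=> ->; rewrite big_mkcond/= !big_ord_recl big_ord0 !inE/= mule1.
by rewrite -!muleA.
Qed.

End mixture_independence.

Section mixture_laws.
Context d (T : measurableType d) {R : realType} (P : probability T R).
Variables (Z1 Z2 S rho : {RV P >-> R}).
Hypothesis indep : mutually_independent (tnth [tuple Z1; Z2; S; rho]).
Hypothesis Z1_normal : has_law P Z1 (normal_prob 0 1).
Hypothesis Z2_normal : has_law P Z2 (normal_prob 0 1).
Local Notation N01 := (@normal_prob R 0 1).
Local Open Scope ereal_scope.

Let R' := measurableTypeR R.

Let Z (w : T) : R' * R' := (Z1 w, Z2 w).

Let mZ : measurable_fun setT Z.
Proof.
exact: (measurable_fun_pair (measurable_funPT Z1) (measurable_funPT Z2)).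
Qed.

Let ZRV : {RV P >-> (R' * R')%type} := HB.pack Z (isMeasurableFun.Build _ _ _ _ Z mZ).

Let PT (U : {RV P >-> R}) : P (U @^-1` setT) = 1.
Proof. by rewrite preimage_setT probability_setT. Qed.

(** [independent_pair] for (Z1, Z2), with an event of S and rho as [E], passes from rectangles to
    arbitrary measurable D in the plane. *)
Lemma normal_pair_independent (D : set (R' * R')) (A B : set R) :
  measurable D -> measurable A -> measurable B ->
  P (rho @^-1` A `&` ZRV @^-1` D `&` S @^-1` B) =
  P (rho @^-1` A) * P (ZRV @^-1` D) * P (S @^-1` B).
Proof.
move=> mD mA mB.
have mE (A' B' : set R) : measurable A' -> measurable B' ->
    measurable (S @^-1` B' `&` rho @^-1` A').
  by move=> mA' mB'; apply: measurableI; rewrite -[X in measurable X]setTI;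
    exact: measurable_funPT.
have PE (A' B' : set R) : measurable A' -> measurable B' ->
    P (S @^-1` B' `&` rho @^-1` A') = P (S @^-1` B') * P (rho @^-1` A').
  move=> mA' mB'; have := independent4 indep measurableT measurableT mB' mA'.
  by rewrite !preimage_setT !setTI probability_setT !mul1e.
have H (A' B' : set R) : measurable A' -> measurable B' ->
    P (Z @^-1` D `&` (S @^-1` B' `&` rho @^-1` A')) =
    (distribution P Z1 \x distribution P Z2) D * (P (S @^-1` B') * P (rho @^-1` A')).
  move=> mA' mB'; rewrite -PE//; apply: independent_pair => //; first exact: mE.
  by move=> A1 A2 mA1 mA2; rewrite PE//; exact: independent4.
have HT := H _ _ measurableT measurableT.
rewrite !preimage_setT setTI setIT probability_setT !mule1 in HT.
have -> : rho @^-1` A `&` ZRV @^-1` D `&` S @^-1` B =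
    Z @^-1` D `&` (S @^-1` B `&` rho @^-1` A).
  by rewrite setIC [rho @^-1` A `&` _]setIC setICA.
by rewrite H// -HT [LHS]muleC [RHS]muleC muleA.
Qed.

(** A second use of [independent_pair], for the pair (rho, (Z1, Z2)) and an event of S. It supplies
    the independence required by [scale_mixture_expansion]. *)
Lemma mixture_scale_independent (g : R * (R * R) -> R) (A B : set R) :
  measurable_fun setT g -> measurable A -> measurable B ->
  P ((fun w => g (rho w, (Z1 w, Z2 w))) @^-1` A `&` S @^-1` B) =
  P ((fun w => g (rho w, (Z1 w, Z2 w))) @^-1` A) * P (S @^-1` B).
Proof.
move=> mg mA mB.
have mgA : measurable (g @^-1` A) by rewrite -[X in measurable X]setTI; exact: mg.
have mSB (B' : set R) : measurable B' -> measurable (S @^-1` B').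
  by move=> mB'; rewrite -[X in measurable X]setTI; exact: measurable_funPT.
have H (B' : set R) : measurable B' ->
    P ((fun w => (rho w, ZRV w)) @^-1` (g @^-1` A) `&` S @^-1` B') =
    (distribution P rho \x distribution P ZRV) (g @^-1` A) * P (S @^-1` B').
  move=> mB'; apply: independent_pair => //; first exact: mSB.
  by move=> A1 D mA1 mD; exact: normal_pair_independent.
have := H _ measurableT; rewrite preimage_setT setIT probability_setT mule1 => HT.
by have := H _ mB; rewrite -HT.
Qed.

(** Conditioning on rho, which is independent of the normal pair: Z1 and Z2 remain independent and
    standard normal while rho is frozen. *)
Lemma mixture_integral (g : R * (R * R) -> \bar R) :
  measurable_fun setT g -> (forall z, 0 <= g z) ->
  \int[P]_w g (rho w, (Z1 w, Z2 w)) =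
  \int[P]_w \int[N01]_x \int[N01]_y g (rho w, (x, y)).
Proof.
move=> mg g0.
have ind A D : measurable A -> measurable D ->
    P (rho @^-1` A `&` ZRV @^-1` D) = P (rho @^-1` A) * P (ZRV @^-1` D).
  move=> mA mD; have := normal_pair_independent mD mA measurableT.
  by rewrite preimage_setT setIT probability_setT mule1.
rewrite [LHS](@independent_integral _ _ _ T R (R' * R')%type R P rho ZRV g ind mg g0).
apply: eq_integral => w _.
transitivity (\int[N01 \x N01]_z g (rho w, z)).
  refine (@eq_measure_integral _ _ R setT (N01 \x N01) (distribution P ZRV) _ _).
  move=> D mD _; apply/esym.
  apply: product_measure_unique => // A B mA mB.
  have := independent4 indep mA mB measurableT measurableT.
  by rewrite !preimage_setT setTI setIT probability_setT !mule1 Z1_normal// Z2_normal.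
rewrite fubini_tonelli1//.
exact: (measurableT_comp mg (pair1_measurable (rho w))).
Qed.

End mixture_laws.

(** * From the margins and the joint tail to the diagonal of the copula *)

Section copula_expansion.
Context {R : realType}.
Implicit Types (C : R -> R -> R).

(** The rectangle inequality on [u, u'] x [0, v] and on [u, u'] x [v, 1] gives 0 <= C(u', v) - C(u,
    v) <= u' - u; the other variable is treated alike. *)
Lemma copula_lipschitz C (a b c e : R) : is_copula C ->
  0 <= a <= 1 -> 0 <= b <= 1 -> 0 <= c <= 1 -> 0 <= e <= 1 ->
  `|C a b - C c e| <= `|a - c| + `|b - e|.
Proof.
move=> [C0 C1 C2].
have L1 u u' v : 0 <= u -> u <= u' -> u' <= 1 -> 0 <= v <= 1 ->
    0 <= C u' v - C u v <= u' - u.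
  move=> u0 uu' u1 /andP[v0 v1].
  have Iu : 0 <= u <= 1 by rewrite u0 (le_trans uu').
  have Iu' : 0 <= u' <= 1 by rewrite u1 (le_trans u0).
  have := C2 u u' 0 v u0 uu' u1 (lexx _) v0 v1.
  have := C2 u u' v 1 u0 uu' u1 v0 v1 (lexx _).
  have [-> _] := C0 u Iu; have [-> _] := C0 u' Iu'.
  have [-> _] := C1 u Iu; have [-> _] := C1 u' Iu'.
  by move=> H1 H2; apply/andP; split; lra.
have L2 u v v' : 0 <= v -> v <= v' -> v' <= 1 -> 0 <= u <= 1 ->
    0 <= C u v' - C u v <= v' - v.
  move=> v0 vv' v1 /andP[u0 u1].
  have Iv : 0 <= v <= 1 by rewrite v0 (le_trans vv').
  have Iv' : 0 <= v' <= 1 by rewrite v1 (le_trans v0).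
  have := C2 0 u v v' (lexx _) u0 u1 v0 vv' v1.
  have := C2 u 1 v v' u0 u1 (lexx _) v0 vv' v1.
  have [_ ->] := C0 v Iv; have [_ ->] := C0 v' Iv'.
  have [_ ->] := C1 v Iv; have [_ ->] := C1 v' Iv'.
  by move=> H1 H2; apply/andP; split; lra.
have N1 u u' v : 0 <= u <= 1 -> 0 <= u' <= 1 -> 0 <= v <= 1 ->
    `|C u v - C u' v| <= `|u - u'|.
  move=> /andP[u0 u1'] /andP[u0' u1''] Iv.
  have [uu|/ltW uu] := leP u u'.
    have /andP[H1 H2] := L1 u u' v u0 uu u1'' Iv.
    by rewrite distrC (distrC u) !ger0_norm ?subr_ge0//; lra.
  have /andP[H1 H2] := L1 u' u v u0' uu u1' Iv.
  by rewrite !ger0_norm ?subr_ge0//; lra.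
have N2 u v v' : 0 <= v <= 1 -> 0 <= v' <= 1 -> 0 <= u <= 1 ->
    `|C u v - C u v'| <= `|v - v'|.
  move=> /andP[u0 u1'] /andP[u0' u1''] Iv.
  have [uu|/ltW uu] := leP v v'.
    have /andP[H1 H2] := L2 u v v' u0 uu u1'' Iv.
    by rewrite distrC (distrC v) !ger0_norm ?subr_ge0//; lra.
  have /andP[H1 H2] := L2 u v' v u0' uu u1' Iv.
  by rewrite !ger0_norm ?subr_ge0//; lra.
move=> Ia Ib Ic Ie.
rewrite (_ : C a b - C c e = (C a b - C c b) + (C c b - C c e)); last first.
  by ring.
by apply: (le_trans (ler_normD _ _)); rewrite lerD// ?N1// N2.
Qed.

(** Both terms are 1 + O(y): Bernoulli's inequality with an integer n >= e bounds the power from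
    below by 1 - n y, and 1/(1 - y) <= 1 + 2 y for y <= 1/2. *)
Lemma powR_onem_bound (e : R) : 0 < e -> exists2 M : R, 0 <= M &
  forall y : R, 0 <= y <= 2^-1 -> `|(1 - y)^-1 - (1 - y) `^ e| <= M * y.
Proof.
move=> e0; pose n := Num.bound e.
have bern (y : R) : 0 <= y <= 2^-1 -> 1 - n%:R * y <= (1 - y) ^+ n.
  move=> /andP[y0 y1]; elim: n => [|k IH]; first by rewrite mul0r subr0 expr0.
  rewrite exprS -natr1; apply: (@le_trans _ _ ((1 - y) * (1 - k%:R * y))).
    have k0 : 0 <= k%:R * y ^+ 2 by rewrite mulr_ge0 ?sqr_ge0.
    by lra.
  by apply: ler_wpM2l => //; lra.
exists (n%:R + 2); first by rewrite addr_ge0.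
move=> y /andP[y0 y1].
have z0 : 0 < 1 - y by lra.
have z1 : 1 - y <= 1 by lra.
have z01 : 0 < 1 - y <= 1 by rewrite z0 z1.
have lo : 1 - n%:R * y <= (1 - y) `^ e.
  apply: (le_trans (bern y _)); first by rewrite y0.
  rewrite -powR_mulrn ?(ltW z0)//; apply: (ger_powR z01).
  exact/ltW/archi_boundP/ltW.
have hi : (1 - y) `^ e <= 1.
  by have := ger_powR z01 (ltW e0); rewrite powRr0.
have inv_ge : 1 <= (1 - y)^-1 by rewrite invf_ge1.
have inv_le : (1 - y)^-1 <= 1 + 2 * y.
  rewrite -[leLHS]mul1r ler_pdivrMr//.
  have y2 : 0 <= 1 - 2 * y by lra.
  by have := mulr_ge0 y0 y2; lra.
by rewrite ger0_norm ?subr_ge0 ?(le_trans hi)//; lra.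
Qed.

(** In place of inverting the margins, h is chosen with A h^nu (1 - beta h^2) = u exactly. Then FX h
    and FY h are within O(h^(nu+4)) of u, and the Lipschitz property transfers the expansion of C(FX
    h, FY h) to C(u, u). With y = beta h^2, division by u gives l0 + (l0 - l1) y / (1 - y) up to
    O(h^4), whereas the claimed second term equals (l0 - l1) y (1 - y)^(2/nu). [powR_onem_bound]
    makes the difference O(y^2). *)
Lemma copula_diag_expansion C (FX FY : R -> R) (nu A beta l0 l1 K : R) :
  is_copula C -> 0 < nu -> 0 < A -> 0 < beta -> 0 <= K ->
  (forall h, 0 < h -> 0 <= FX h <= 1) -> (forall h, 0 < h -> 0 <= FY h <= 1) ->
  (forall h, 0 < h ->
    `|FX h - A * h `^ nu * (1 - beta * h ^+ 2)| <= K * h `^ nu * h ^+ 4) ->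
  (forall h, 0 < h ->
    `|FY h - A * h `^ nu * (1 - beta * h ^+ 2)| <= K * h `^ nu * h ^+ 4) ->
  (forall h, 0 < h ->
    `|C (FX h) (FY h) - A * h `^ nu * (l0 - beta * l1 * h ^+ 2)| <=
      K * h `^ nu * h ^+ 4) ->
  exists M u0 : R, [/\ 0 <= M, 0 < u0 & forall u, 0 < u < u0 ->
    `|u^-1 * C u u - (l0 + A `^ (- (2 / nu)) * (beta * (l0 - l1)) * u `^ (2 / nu))|
      <= M * u `^ (4 / nu)].
Proof.
move=> Ccop nu0 A0 b0 K0 FX01 FY01 FXE FYE JE.
have e0 : 0 < 2 / nu by rewrite divr_gt0.
have [M0 M00 M0P] := powR_onem_bound e0.
(* At [h0] one has beta h^2 = 1/2, so h <= h0 keeps 1 - y at least 1/2. *)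
pose h0 := Num.sqrt (2 * beta)^-1.
have bb0 : 0 < 2 * beta by rewrite mulr_gt0.
have h00 : 0 < h0 by rewrite sqrtr_gt0 invr_gt0.
have h02 : h0 ^+ 2 = (2 * beta)^-1 by rewrite sqr_sqrtr// invr_ge0 ltW.
have bh0 : beta * h0 ^+ 2 = 2^-1 by rewrite h02; field; rewrite gt_eqF.
pose g h := A * h `^ nu * (1 - beta * h ^+ 2).
have gh0 : g h0 = A * h0 `^ nu / 2 by rewrite /g bh0; field.
(* The first term is the cost of exchanging 1 / (1 - y) for the power of 1 - y. In the second, 3 K
   collects the two margins and the joint estimate, and a factor 2 comes from u >= A h^nu / 2. *)
pose M1 := `|l0 - l1| * beta * (M0 * beta) + 6 * K / A.
have M10 : 0 <= M1.
  by rewrite addr_ge0 ?divr_ge0 ?mulr_ge0 ?(ltW A0) ?(ltW b0).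
(* The power of 2 / A converts h^4 into u^(4/nu). The threshold [g h0] brings u within reach of [g]
   on ]0, h0], and 1 keeps u in the unit interval. *)
exists (M1 * (2 / A) `^ (4 / nu)), (Num.min (g h0) 1); split.
- by rewrite mulr_ge0 ?powR_ge0.
- by rewrite lt_min ltr01 andbT gh0 divr_gt0// mulr_gt0// powR_gt0.
move=> u /andP[u0]; rewrite lt_min => /andP[ugh u1].
have uA0 : 0 < u / A by rewrite divr_gt0.
(* Left end for the intermediate value theorem: A dl^nu = u, hence g dl <= u. *)
pose dl := (u / A) `^ nu^-1.
have dl0 : 0 < dl by rewrite powR_gt0.
have dlnu : dl `^ nu = u / A.
  by rewrite /dl -powRrM mulVf ?gt_eqF// powRr1// ltW.
have gdl : g dl <= u.
  rewrite /g dlnu mulrCA divff ?gt_eqF// mulr1 -[leRHS]mulr1 ler_wpM2l ?(ltW u0)//.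
  by rewrite gerBl mulr_ge0 ?(ltW b0) ?sqr_ge0.
have dlh0 : dl <= h0.
  rewrite leNgt; apply/negP => h0dl.
  have : u < A * h0 `^ nu.
    apply: (lt_le_trans ugh); rewrite gh0 ler_pdivrMr// ler_peMr//; last by lra.
    by rewrite mulr_ge0 ?powR_ge0 ?(ltW A0).
  have : h0 `^ nu <= dl `^ nu.
    by apply: ge0_ler_powR; rewrite ?nnegrE ?(ltW nu0) ?(ltW dl0) ?(ltW h00) ?(ltW h0dl).
  rewrite dlnu ler_pdivlMr// mulrC => H1 H2.
  by have := lt_le_trans H2 H1; rewrite ltxx.
have [h hin gh] : exists2 h, h \in `[dl, h0] & g h = u.
  apply: IVT => //; last first.
    by rewrite ge_min gdl/= le_max (ltW ugh) orbT.
  apply: derivable_within_continuous => h; rewrite in_itv/= => /andP[dlh _].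
  have hp : 0 < h := lt_le_trans dl0 dlh.
  have dpow : derivable (@powR R ^~ nu) h 1.
    by apply: derivable_powR; rewrite in_itv/= hp.
  apply: derivableM; first exact: derivableM.
  by apply: derivableB => //; apply: derivableM.
move: hin; rewrite in_itv/= => /andP[dlh hh0].
have hp : 0 < h := lt_le_trans dl0 dlh.
pose G := A * h `^ nu.
have G0 : 0 < G by rewrite mulr_gt0// powR_gt0.
pose y := beta * h ^+ 2.
have y0 : 0 <= y by rewrite mulr_ge0 ?sqr_ge0 ?(ltW b0).
have y1 : y <= 2^-1.
  by rewrite -bh0 ler_pM2l// ler_sqr ?nnegrE ?(ltW hp) ?(ltW h00).
have uE : u = G * (1 - y) by rewrite -gh.
have z0 : 0 < 1 - y by lra.
have uG : G / 2 <= u by rewrite uE ler_pM2l//; lra.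
have u01 : 0 <= u <= 1 by rewrite !ltW.
have JC : `|C u u - G * (l0 - l1 * y)| <= 3 * K * h `^ nu * h ^+ 4.
  have H1 := copula_lipschitz Ccop u01 u01 (FX01 h hp) (FY01 h hp).
  have H2 := FXE h hp; have H3 := FYE h hp; have H4 := JE h hp.
  rewrite -/G -/y -uE distrC in H2; rewrite -/G -/y -uE distrC in H3.
  rewrite (_ : C u u - _ = (C u u - C (FX h) (FY h)) +
    (C (FX h) (FY h) - A * h `^ nu * (l0 - beta * l1 * h ^+ 2))); last first.
    by rewrite /G /y; ring.
  apply: (le_trans (ler_normD _ _)).
  by lra.
have ue : u `^ (2 / nu) = A `^ (2 / nu) * h ^+ 2 * (1 - y) `^ (2 / nu).
  rewrite uE powRM ?(ltW G0) ?(ltW z0)// /G powRM ?powR_ge0 ?(ltW A0)//.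
  rewrite -[in (h `^ nu) `^ _]powRrM (_ : nu * (2 / nu) = 2); last first.
    by field; rewrite gt_eqF.
  by rewrite powR_mulrn ?(ltW hp).
have gamE : A `^ (- (2 / nu)) * (beta * (l0 - l1)) * u `^ (2 / nu) =
    (l0 - l1) * y * (1 - y) `^ (2 / nu).
  by rewrite ue powRN /y; field; rewrite gt_eqF// powR_gt0.
have h4 : h ^+ 4 <= (2 / A) `^ (4 / nu) * u `^ (4 / nu).
  rewrite -powRM ?divr_ge0 ?(ltW A0) ?(ltW u0)//.
  have -> : h ^+ 4 = (h `^ nu) `^ (4 / nu).
    rewrite -powRrM (_ : nu * (4 / nu) = 4); last by field; rewrite gt_eqF.
    by rewrite powR_mulrn ?(ltW hp).
  apply: ge0_ler_powR; rewrite ?nnegrE ?powR_ge0 ?divr_ge0 ?(ltW nu0)//.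
    by rewrite mulr_ge0 ?divr_ge0 ?(ltW A0) ?(ltW u0).
  rewrite mulrAC ler_pdivlMr//; move: uG; rewrite /G; lra.
rewrite gamE.
have -> : u^-1 * C u u - (l0 + (l0 - l1) * y * (1 - y) `^ (2 / nu)) =
   (l0 - l1) * y * ((1 - y)^-1 - (1 - y) `^ (2 / nu)) +
   u^-1 * (C u u - G * (l0 - l1 * y)).
  by rewrite uE; field; rewrite !gt_eqF.
apply: (le_trans (ler_normD _ _)).
have B1 : `|(l0 - l1) * y * ((1 - y)^-1 - (1 - y) `^ (2 / nu))| <=
    `|l0 - l1| * beta * (M0 * beta) * h ^+ 4.
  have -> : `|l0 - l1| * beta * (M0 * beta) * h ^+ 4 = `|l0 - l1| * (y * (M0 * y)).
    by rewrite /y; ring.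
  by rewrite normrM normrM (ger0_norm y0) -mulrA ler_wpM2l// ler_wpM2l// M0P// y0.
have B2 : `|u^-1 * (C u u - G * (l0 - l1 * y))| <= 6 * K / A * h ^+ 4.
  rewrite normrM gtr0_norm ?invr_gt0// mulrC ler_pdivrMr//.
  apply: (le_trans JC).
  have -> : 3 * K * h `^ nu * h ^+ 4 = 6 * K / A * h ^+ 4 * (G / 2).
    by rewrite /G; field; rewrite gt_eqF.
  by apply: ler_wpM2l => //; rewrite mulr_ge0 ?exprn_ge0 ?divr_ge0 ?mulr_ge0 ?(ltW A0) ?(ltW hp).
apply: (@le_trans _ _ (M1 * h ^+ 4)); first by rewrite /M1 [leRHS]mulrDl lerD.
by rewrite -mulrA ler_wpM2l.
Qed.

End copula_expansion.

(** * Moments of the mixed normal pair given the correlation *)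

Section correlation_mixture.
Context {R : realType}.
Local Notation N01 := (@normal_prob R 0 1).

(** The argument is (rho, (Z1, Z2)). The sign is chosen so that X <= -1/h reads S <= h [mix_fst];
    likewise [mix_snd] for Y, and [mix_min] for both at once. *)
Definition mix_fst (z : R * (R * R)) : R := - z.2.1.

Definition mix_snd (z : R * (R * R)) : R :=
  - (z.1 * z.2.1 + Num.sqrt (1 - z.1 ^+ 2) * z.2.2).

Definition mix_min (z : R * (R * R)) : R := Num.min (mix_fst z) (mix_snd z).

Lemma measurable_mix_fst : measurable_fun setT mix_fst.
Proof. by apply: measurableT_comp => //; apply: measurableT_comp. Qed.

Lemma measurable_mix_snd : measurable_fun setT mix_snd.
Proof.
apply: measurableT_comp => //; apply: measurable_funD; apply: measurable_funM => //.
- by apply: measurableT_comp => //.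
- apply: (@measurableT_comp _ _ _ _ _ _ (@Num.sqrt R)).
    by apply: continuous_measurable_fun; exact: sqrt_continuous.
  by apply: measurable_funB => //; apply: measurable_funX.
- by apply: measurableT_comp => //.
Qed.

Lemma measurable_mix_min : measurable_fun setT mix_min.
Proof. exact: measurable_minr measurable_mix_fst measurable_mix_snd. Qed.

Lemma integral_normal_cst (c : R) : (\int[N01]_y c%:E = c%:E)%E.
Proof.
rewrite integral_cst// [X in (_ * X)%E](_ : _ = 1%E) ?mule1//.
exact: probability_setT.
Qed.

Lemma integral_normal2_opp (g : R * R -> \bar R) :
  measurable_fun setT g -> (forall z, 0 <= g z)%E ->
  (\int[N01]_x \int[N01]_y g (- x, - y)%R = \int[N01]_x \int[N01]_y g (x, y))%E.
Proof.
move=> mg g0.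
rewrite -[RHS]ge0_integral_normal_opp.
- apply: eq_integral => x _.
  rewrite (@ge0_integral_normal_opp _ (fun y => g (- x, y)))//.
  exact: (measurableT_comp mg (pair1_measurable _)).
- exact: (measurable_fun_fubini_tonelli_F (m2 := N01) _ mg).
- by move=> x; exact: integral_ge0.
Qed.

Lemma normal2_moment_fst (p r : R) : 0 < p ->
  (\int[N01]_x \int[N01]_y ((Num.max (mix_fst (r, (x, y))) 0) `^ p)%:E =
   (moment_const p)%:E)%E.
Proof.
move=> p0; rewrite -normal_pos_momentE// -[RHS]ge0_integral_normal_opp.
- apply: eq_integral => x _; rewrite /mix_fst/=; exact: integral_normal_cst.
- by apply/measurable_EFinP; exact: measurable_max0_powR.
- by move=> x; rewrite lee_fin powR_ge0.
Qed.

Lemma rotation_coef (r : R) : -1 < r < 1 ->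
  0 < Num.sqrt (1 - r ^+ 2) /\ r ^+ 2 + Num.sqrt (1 - r ^+ 2) ^+ 2 = 1.
Proof.
move=> /andP[r1 r2]; have h : 0 < 1 - r ^+ 2.
  have h1 : 0 < 1 - r by lra.
  have h2 : 0 < 1 + r by lra.
  by have := mulr_gt0 h1 h2; lra.
by split; rewrite ?sqrtr_gt0// sqr_sqrtr ?ltW//; ring.
Qed.

(** After the signs are removed by symmetry, [normal_rotation_sym] applied to a function of the
    second coordinate alone replaces r x + s z by x: the combination is standard normal. *)
Lemma normal2_moment_snd (p r : R) : 0 < p -> -1 < r < 1 ->
  (\int[N01]_x \int[N01]_y ((Num.max (mix_snd (r, (x, y))) 0) `^ p)%:E =
   (moment_const p)%:E)%E.
Proof.
move=> p0 r1; have [s0 rs] := rotation_coef r1.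
rewrite -[LHS](integral_normal2_opp
  (g := fun z => ((Num.max (mix_snd (r, (z.1, z.2))) 0) `^ p)%:E)); last 2 first.
- apply/measurable_EFinP; apply: (measurableT_comp (measurable_max0_powR p)).
  apply: (measurableT_comp measurable_mix_snd); apply: measurable_fun_pair => //.
  exact: measurable_fun_pair.
- by move=> z; rewrite lee_fin powR_ge0.
transitivity (\int[N01]_x \int[N01]_z
   (fun u : R * R => ((Num.max u.2 0) `^ p)%:E)
     (x, r * x + Num.sqrt (1 - r ^+ 2) * z)%R)%E.
  apply: eq_integral => x _; apply: eq_integral => z _; rewrite /mix_snd /=.
  by rewrite !mulrN opprD !opprK.
rewrite (normal_rotation_sym (h := fun u : R * R => ((Num.max u.2 0) `^ p)%:E))//=.
- rewrite -normal_pos_momentE//; apply: eq_integral => x _.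
  exact: integral_normal_cst.
- by apply/measurable_EFinP; apply: (measurableT_comp (measurable_max0_powR p)).
- by move=> z; rewrite lee_fin powR_ge0.
Qed.

Lemma normal2_moment_min (p r : R) : 0 < p -> -1 < r < 1 ->
  (\int[N01]_x \int[N01]_y ((Num.max (mix_min (r, (x, y))) 0) `^ p)%:E =
   (moment_const p * tail_coef p r)%:E)%E.
Proof.
move=> p0 r1; apply: etrans (normal_min_moment p0 r1).
rewrite -[LHS](integral_normal2_opp
  (g := fun z => ((Num.max (mix_min (r, (z.1, z.2))) 0) `^ p)%:E)); last 2 first.
- apply/measurable_EFinP; apply: (measurableT_comp (measurable_max0_powR p)).
  apply: (measurableT_comp measurable_mix_min); apply: measurable_fun_pair => //.
  exact: measurable_fun_pair.
- by move=> z; rewrite lee_fin powR_ge0.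
apply: eq_integral => x _; apply: eq_integral => z _.
by rewrite /mix_min /mix_fst /mix_snd /= !mulrN opprD !opprK.
Qed.

(** Measurability of [tail_coef p] along rho is read off from this double integral through
    [normal2_moment_min], rather than from the defining formula. *)
Lemma measurable_normal2_moment_min (p : R) :
  measurable_fun setT (fun r : R =>
    \int[N01]_x \int[N01]_y ((Num.max (mix_min (r, (x, y))) 0) `^ p)%:E)%E.
Proof.
have m1 : measurable_fun setT (fun z : (R * R) * R =>
    ((Num.max (mix_min (z.1.1, (z.1.2, z.2))) 0) `^ p)%:E).
  apply/measurable_EFinP; apply: (measurableT_comp (measurable_max0_powR p)).
  apply: (measurableT_comp measurable_mix_min).
  apply: measurable_fun_pair; first by apply: measurableT_comp.
  by apply: measurable_fun_pair => //; apply: measurableT_comp.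
have p0 (z : (R * R) * R) : (0 <= ((Num.max (mix_min (z.1.1, (z.1.2, z.2))) 0) `^ p)%:E)%E.
  by rewrite lee_fin powR_ge0.
have m2 := measurable_fun_fubini_tonelli_F (m2 := N01) _ m1 p0.
apply: (measurable_fun_fubini_tonelli_F (m2 := N01) _ m2).
by move=> z; apply: integral_ge0 => y _; rewrite lee_fin powR_ge0.
Qed.

End correlation_mixture.

(** * The expected tail coefficient *)

Section expected_tail_coefficient.
Context d (T : measurableType d) {R : realType} (P : probability T R).
Variables (rho : {RV P >-> R}).
Hypothesis rho_itv : forall w, -1 < rho w < 1.

Lemma measurable_tail_coef_rho (p : R) : 0 < p ->
  measurable_fun setT (fun w => tail_coef p (rho w)).
Proof.
move=> p0; apply/measurable_EFinP.
have m0 := moment_const_gt0 p0.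
apply: (@eq_measurable_fun _ _ _ _ _ (fun w =>
  (moment_const p)^-1%:E * (\int[normal_prob 0 1]_x \int[normal_prob 0 1]_y
     ((Num.max (mix_min (rho w, (x, y))) 0) `^ p)%:E))%E).
  move=> w _; rewrite normal2_moment_min// -EFinM mulrA mulVf ?gt_eqF// mul1r.
  by [].
apply: emeasurable_funM => //.
exact: (measurableT_comp (measurable_normal2_moment_min p) (measurable_funPT rho)).
Qed.

Lemma integrable_tail_coef (p : R) : 0 < p ->
  P.-integrable setT (fun w => (tail_coef p (rho w))%:E).
Proof.
move=> p0; apply: (@le_integrable _ _ _ P _ measurableT _ (cst 2%:E)).
- by apply/measurable_EFinP; exact: measurable_tail_coef_rho.
- move=> w _ /=; rewrite lee_fin !ger0_norm ?tail_coef_ge0//.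
  exact: tail_coef_le2.
- exact: finite_measure_integrable_cst.
Qed.

Definition mean_tail (p : R) : R := fine ('E_P[(fun w => tail_coef p (rho w))%R])%E.

Lemma mean_tailE (p : R) : 0 < p ->
  (mean_tail p)%:E = (\int[P]_w (tail_coef p (rho w))%:E)%E.
Proof.
move=> p0; rewrite /mean_tail unlock fineK//.
by apply: integrable_fin_num => //; exact: integrable_tail_coef.
Qed.

Lemma integral_tail_coef_diff (p : R) : 0 < p ->
  (\int[P]_w (tail_coef p (rho w) - tail_coef (p + 2) (rho w))%:E =
   (mean_tail p - mean_tail (p + 2))%:E)%E.
Proof.
move=> p0; have p20 : 0 < p + 2 by rewrite addr_gt0.
rewrite EFinB !mean_tailE//.
by apply: integralB_EFin => //; exact: integrable_tail_coef.
Qed.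

Lemma mean_tail_diff (p : R) : 0 < p ->
  fine ('E_P[(fun w => tail_coef p (rho w) - tail_coef (p + 2) (rho w))%R])%E =
  mean_tail p - mean_tail (p + 2).
Proof. by move=> p0; rewrite unlock integral_tail_coef_diff. Qed.

(** The difference [f] is positive everywhere by [tail_coef_lt]; a zero integral would make the
    whole space a null set. *)
Lemma mean_tail_lt (p : R) : 0 < p -> mean_tail (p + 2) < mean_tail p.
Proof.
move=> p0; have p20 : 0 < p + 2 by rewrite addr_gt0.
pose f w : R := tail_coef p (rho w) - tail_coef (p + 2) (rho w).
have f0 w : 0 < f w by rewrite subr_gt0 tail_coef_lt.
have mf : measurable_fun setT (EFin \o f).
  apply/measurable_EFinP; apply: measurable_funB; exact: measurable_tail_coef_rho.
have E := integral_tail_coef_diff p0; rewrite -subr_gt0 -lte_fin -E lt0e; apply/andP; split; last first.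
  by apply: integral_ge0 => w _; rewrite lee_fin; exact/ltW/f0.
apply/eqP => I0.
have /(ae_eq_integral_abs P measurableT mf) : (\int[P]_w `|(EFin \o f) w| = 0)%E.
  by rewrite -I0; apply: eq_integral => w _ /=; rewrite ger0_norm//; exact/ltW/f0.
move=> [N [mN PN0 NT]].
have NTT : N = setT.
  apply/seteqP; split => // w _; apply: NT => /= /(_ I)[fw].
  by have := f0 w; rewrite fw ltxx.
have : P N = 0%E by []; rewrite NTT probability_setT.
by move=> [] /eqP; rewrite oner_eq0.
Qed.

End expected_tail_coefficient.

(** * Tail expansions for the mixture and the conclusion *)

Section mixture_tail.
Context d (T : measurableType d) {R : realType} (P : probability T R).
Variables (nu : R) (Z1 Z2 S rho : {RV P >-> R}).
Hypotheses (nu_gt0 : 0 < nu)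
  (indep : mutually_independent (tnth [tuple Z1; Z2; S; rho]))
  (S_gt0 : forall w, 0 < S w)
  (S_chi2 : has_law P (fun w => nu * S w ^+ 2) (chi_square_prob nu)).

(** Covers the margins and the joint tail alike: [L p] is the ratio of E[g_+^p] to [moment_const p],
    equal to 1 for the margins and to the mean tail coefficient for the minimum. [moment_constSS]
    brings in nu + 1. *)
Lemma mixture_tail_expansion (g : R * (R * R) -> R) (L : R -> R) (K h : R) :
  measurable_fun setT g ->
  (forall p, 0 < p -> (\int[P]_w ((Num.max (g (rho w, (Z1 w, Z2 w))) 0) `^ p)%:E =
    (moment_const p * L p)%:E)%E) ->
  rest_const nu * moment_const (nu + 4) * L (nu + 4) <= K -> 0 < h ->
  `|fine (P [set w | S w <= h * g (rho w, (Z1 w, Z2 w))]) -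
    a_const nu * moment_const nu * h `^ nu *
      (L nu - b_const nu * (nu + 1) * L (nu + 2) * h ^+ 2)| <= K * h `^ nu * h ^+ 4.
Proof.
move=> mg ML LK h0.
have mU : measurable_fun setT (fun w => g (rho w, (Z1 w, Z2 w))).
  apply: (measurableT_comp mg); apply: measurable_fun_pair => //.
  exact: measurable_fun_pair.
have [] := @scale_mixture_expansion _ T R P nu S _ h
  (measurable_funPT S) mU nu_gt0 S_gt0 S_chi2 _ h0.
  by move=> A B mA mB; exact: mixture_scale_independent.
rewrite !ML ?addr_gt0//; set E := [set w | _].
have mE : measurable E.
  have mb : measurable_fun setT (fun w => S w <= h * g (rho w, (Z1 w, Z2 w))).
    by apply: measurable_fun_ler => //; exact: measurable_funM.
  by rewrite -[X in measurable X]setTI; exact: (mb measurableT [set true]).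
rewrite -[P E]fineK ?fin_num_measure// -!EFinM -!EFinD !lee_fin.
have hn : h != 0 by rewrite gt_eqF.
have h2 : h `^ (nu + 2) = h `^ nu * h ^+ 2.
  by rewrite powRD ?hn ?implybT// powR_mulrn// ltW.
have h4 : h `^ (nu + 4) = h `^ nu * h ^+ 4.
  by rewrite powRD ?hn ?implybT// powR_mulrn// ltW.
rewrite h2 h4 moment_constSS// => lo hi.
have hp : 0 <= h `^ nu * h ^+ 4 by rewrite mulr_ge0 ?powR_ge0 ?exprn_ge0// ltW.
have := ler_wpM2r hp LK.
move: lo hi; move: (fine _) (h `^ nu) (moment_const _) (moment_const (nu + 4)) (L nu)
  (L (nu + 2)) (L (nu + 4)) => F H m m4 L0 L2 L4 lo hi LK'.
by rewrite ger0_norm /=; lra.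
Qed.

End mixture_tail.

(** Multiplication by s h; it converts a lower tail of X or Y at -1/h into an upper bound on S. *)
Lemma scale_leN (R : realType) (s h v : R) : 0 < s -> 0 < h ->
  (s^-1 * v <= - h^-1) = (s <= h * - v).
Proof.
move=> s0 h0; rewrite -(ler_pM2l (mulr_gt0 s0 h0)).
have -> : s * h * (s^-1 * v) = h * v by field; rewrite gt_eqF.
have -> : s * h * - h^-1 = - s by field; rewrite gt_eqF.
by rewrite mulrN lerNr.
Qed.

Theorem proposition3 (d : measure_display) (T : measurableType d)
    (R : realType) (P : probability T R) (nu : R)
    (Z1 Z2 S rho X Y : {RV P >-> R}) (C : R -> R -> R)
    (nu_gt0 : 0 < nu)
    (indep : mutually_independent (tnth [tuple Z1; Z2; S; rho]))
    (Z1_normal : has_law P Z1 (normal_prob 0 1))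
    (Z2_normal : has_law P Z2 (normal_prob 0 1))
    (S_gt0 : forall w, 0 < S w)
    (S_chi2 : has_law P (fun w => nu * S w ^+ 2) (chi_square_prob nu))
    (rho_itv : forall w, -1 < rho w < 1)
    (X_def : forall w, X w = (S w)^-1 * Z1 w)
    (Y_def : forall w, Y w =
       (S w)^-1 * (rho w * Z1 w + Num.sqrt (1 - rho w ^+ 2) * Z2 w))
    (C_copula : copula_of X Y C) :
  let lambda_fun := fun u : R => u^-1 * C u u in
  let lambda : R := fine ('E_P[(fun w => tail_coef nu (rho w))%R])%E in
  let gamma := gamma_const nu rho in
  [/\ lambda_fun u @[u --> 0^'+] --> lambda,
      0 < gamma
    & lambda_fun = (fun u : R => lambda + gamma * u `^ (2 / nu))
        +o_ (0^'+) (fun u : R => u `^ (2 / nu))].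
Proof.
move=> lambda_fun lambda gamma.
have [Ccop CXY] := C_copula.
pose A := a_const nu * moment_const nu.
pose beta := b_const nu * (nu + 1).
pose l1 := mean_tail rho (nu + 2).
have nu2 : 0 < nu / 2 by rewrite divr_gt0.
have m0 := moment_const_gt0 nu_gt0.
have nu4 : 0 < nu + 4 by rewrite addr_gt0.
have A0 : 0 < A.
  by rewrite mulr_gt0// /a_const divr_gt0 ?powR_gt0// Gamma_gt0// addr_gt0.
have beta0 : 0 < beta.
  by rewrite mulr_gt0 ?addr_gt0// /b_const divr_gt0 ?exprn_gt0// addr_gt0.
have ll : l1 < lambda by exact: mean_tail_lt.
have gammaE : gamma = A `^ (- (2 / nu)) * (beta * (lambda - l1)).
  rewrite /gamma /gamma_const fine_normal_pos_moment// mean_tail_diff//.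
  by rewrite -/A -/l1 /beta !mulrA.
have gamma0 : 0 < gamma.
  by rewrite gammaE mulr_gt0 ?powR_gt0// mulr_gt0// subr_gt0.
pose c4 := rest_const nu * moment_const (nu + 4).
have c40 : 0 <= c4 by rewrite mulr_ge0 ?rest_const_ge0// ltW// moment_const_gt0.
(* One remainder constant for the three expansions, dominating both [L = 1] and
   [L = mean_tail rho]. *)
pose K := c4 * (1 + `|mean_tail rho (nu + 4)|).
have K0 : 0 <= K by rewrite mulr_ge0// addr_ge0.
pose V w := (rho w, (Z1 w, Z2 w)).
have mom (g : R * (R * R) -> R) p : measurable_fun setT g ->
    (\int[P]_w ((Num.max (g (V w)) 0) `^ p)%:E =
     \int[P]_w \int[normal_prob 0 1]_x \int[normal_prob 0 1]_y
       ((Num.max (g (rho w, (x, y))) 0) `^ p)%:E)%E.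
  move=> mg; apply: (mixture_integral indep Z1_normal Z2_normal
      (g := fun z => ((Num.max (g z) 0) `^ p)%:E)).
  - by apply/measurable_EFinP; exact: (measurableT_comp (measurable_max0_powR p)).
  - by move=> z; rewrite lee_fin powR_ge0.
have M1 p : 0 < p -> (\int[P]_w ((Num.max (mix_fst (V w)) 0) `^ p)%:E =
    (moment_const p * (fun=> 1) p)%:E)%E.
  move=> p0; rewrite mom ?mulr1; last exact: measurable_mix_fst.
  under eq_integral do rewrite normal2_moment_fst//.
  by rewrite integral_cst//= probability_setT mule1.
have M2 p : 0 < p -> (\int[P]_w ((Num.max (mix_snd (V w)) 0) `^ p)%:E =
    (moment_const p * (fun=> 1) p)%:E)%E.
  move=> p0; rewrite mom ?mulr1; last exact: measurable_mix_snd.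
  under eq_integral do rewrite normal2_moment_snd//.
  by rewrite integral_cst//= probability_setT mule1.
have M3 p : 0 < p -> (\int[P]_w ((Num.max (mix_min (V w)) 0) `^ p)%:E =
    (moment_const p * mean_tail rho p)%:E)%E.
  move=> p0; rewrite mom; last exact: measurable_mix_min.
  under eq_integral do rewrite normal2_moment_min//.
  rewrite EFinM mean_tailE// ge0_integralZl_fin//.
  - exact: measurable_tail_coef_rho.
  - by move=> w; exact: tail_coef_ge0.
  - exact/ltW/moment_const_gt0.
pose FX h := fine (cdf X (- h^-1)); pose FY h := fine (cdf Y (- h^-1)).
have F01 (Q : {RV P >-> R}) h : 0 <= fine (cdf Q (- h^-1)) <= 1.
  rewrite fine_ge0 ?cdf_ge0//= -lee_fin fineK ?cdf_le1//.
  exact: fin_num_measure.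
have XE h : 0 < h -> X @^-1` `]-oo, - h^-1] = [set w | S w <= h * mix_fst (V w)].
  by move=> h0; apply/seteqP; split => w /=; rewrite in_itv/= X_def scale_leN.
have YE h : 0 < h -> Y @^-1` `]-oo, - h^-1] = [set w | S w <= h * mix_snd (V w)].
  by move=> h0; apply/seteqP; split => w /=; rewrite in_itv/= Y_def scale_leN.
have XYE h : 0 < h -> X @^-1` `]-oo, - h^-1] `&` Y @^-1` `]-oo, - h^-1] =
    [set w | S w <= h * mix_min (V w)].
  move=> h0; rewrite XE// YE//; apply/seteqP; split => w /=.
    move=> [w1 w2]; rewrite -ler_pdivrMl// le_min !ler_pdivrMl//.
    exact/andP.
  rewrite -ler_pdivrMl// le_min !ler_pdivrMl//.
  by move=> /andP.
have K1 : rest_const nu * moment_const (nu + 4) * (fun=> 1) (nu + 4) <= K.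
  by rewrite mulr1 /K -/c4 ler_peMr// lerDl.
have K3 : rest_const nu * moment_const (nu + 4) * mean_tail rho (nu + 4) <= K.
  by rewrite /K -/c4 ler_wpM2l// (le_trans (ler_norm _))// lerDr.
have FXE h : 0 < h ->
    `|FX h - A * h `^ nu * (1 - beta * h ^+ 2)| <= K * h `^ nu * h ^+ 4.
  move=> h0; have := mixture_tail_expansion nu_gt0 indep S_gt0 S_chi2
    measurable_mix_fst M1 K1 h0.
  by rewrite mulr1 -XE.
have FYE h : 0 < h ->
    `|FY h - A * h `^ nu * (1 - beta * h ^+ 2)| <= K * h `^ nu * h ^+ 4.
  move=> h0; have := mixture_tail_expansion nu_gt0 indep S_gt0 S_chi2
    measurable_mix_snd M2 K1 h0.
  by rewrite mulr1 -YE.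
have JE h : 0 < h ->
    `|C (FX h) (FY h) - A * h `^ nu * (lambda - beta * l1 * h ^+ 2)| <=
      K * h `^ nu * h ^+ 4.
  move=> h0; have := mixture_tail_expansion nu_gt0 indep S_gt0 S_chi2
    measurable_mix_min M3 K3 h0.
  by rewrite -XYE// CXY.
have [M [u0 [M0 u00 MP]]] := copula_diag_expansion Ccop nu_gt0 A0 beta0 K0
  (fun h _ => F01 X h) (fun h _ => F01 Y h) FXE FYE JE.
have e0 : 0 < 2 / nu by rewrite divr_gt0.
(* The error M u^(4/nu) is split as M u^(2/nu) times u^(2/nu): the first factor tends to 0, which
   gives the little-o. *)
have est u : 0 < u < u0 ->
    `|lambda_fun u - (lambda + gamma * u `^ (2 / nu))| <=
      M * u `^ (2 / nu) * u `^ (2 / nu).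
  move=> /andP[u1 u2]; have := MP u; rewrite u1 u2 -gammaE => /(_ isT).
  rewrite (_ : 4 / nu = 2 / nu + 2 / nu); last by field; rewrite gt_eqF.
  by rewrite powRD ?(gt_eqF u1) ?implybT// mulrA.
have small (e : R) : 0 < e -> \forall u \near 0^'+, u `^ (2 / nu) < e.
  move=> e1; have /cvgrPdist_lt/(_ _ e1) := powR_cvg0 e0.
  by apply: filterS => u; rewrite sub0r normrN ger0_norm ?powR_ge0.
split => //.
- apply/cvgrPdist_le => e e1.
  (* Once u^(2/nu) < 1, the deviation from lambda is at most (gamma + M) u^(2/nu), which is below e
     when u^(2/nu) < e / k. *)
  pose k := gamma + M + 1.
  have k0 : 0 < k by rewrite /k; lra.
  near=> u.
  have u1 : 0 < u by near: u; exact: nbhs_right_gt.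
  have u2 : u < u0 by near: u; exact: nbhs_right_lt.
  have v1 : u `^ (2 / nu) < 1 by near: u; exact: small.
  have v2 : u `^ (2 / nu) < e / k by near: u; apply: small; rewrite divr_gt0.
  have v0 : 0 <= u `^ (2 / nu) by exact: powR_ge0.
  have := est u; rewrite u1 u2 => /(_ isT) H.
  move: v2; rewrite ltr_pdivlMr// => v2.
  rewrite distrC.
  rewrite (_ : lambda_fun u - lambda = gamma * u `^ (2 / nu) +
    (lambda_fun u - (lambda + gamma * u `^ (2 / nu)))); last by ring.
  apply: (le_trans (ler_normD _ _)).
  rewrite (ger0_norm (mulr_ge0 (ltW gamma0) v0)).
  have Mv : M * u `^ (2 / nu) * u `^ (2 / nu) <= M * u `^ (2 / nu).
    by rewrite ler_piMr ?mulr_ge0// ltW.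
  by move: v2; rewrite /k; lra.
- apply/eqaddoP => e e1.
  near=> u.
  have u1 : 0 < u by near: u; exact: nbhs_right_gt.
  have u2 : u < u0 by near: u; exact: nbhs_right_lt.
  (* The constant M may be 0, hence the denominator M + 1. *)
  have v2 : u `^ (2 / nu) < e / (M + 1).
    by near: u; apply: small; rewrite divr_gt0// ltr_wpDl.
  have v0 : 0 <= u `^ (2 / nu) by exact: powR_ge0.
  have := est u; rewrite u1 u2 => /(_ isT) H.
  rewrite (ger0_norm v0); apply: (le_trans H); apply: ler_wpM2r => //.
  move: v2; rewrite ltr_pdivlMr ?ltr_wpDl// => v2.
  by lra.
Unshelve. all: by end_near. Qed.
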